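(* Let $1\le q<\ell<p$ be integers. Let $\tilde{\mathcal K}$ be the family of all subsets of $\{q+1,\dots,p\}$ and $\mathcal K^*$ the family of all subsets of $\{\ell+1,\dots,p\}$ (both including the empty set). Consider the following 4 cases. Case 1. $\tilde K$ minimizes $AIC(K)$ with respect to $K\in\tilde{\mathcal K}$, and $K^*$ minimizes $AIC(K)$ with respect to $K\in\mathcal K^*$. Case 2. $\tilde K$ minimizes $C_K$ with respect to $K\in\tilde{\mathcal K}$, and $K^*$ minimizes $C_K$ with respect to $K\in\mathcal K^*$. Case 3. $\tilde K$ minimizes $B_K$ with respect to $K\in\tilde{\mathcal K}$, and $K^*$ minimizes $B_K$ with respect to $K\in\mathcal K^*$. Case 4. $\tilde K$ consists of the set of $j\in\{q+1,\dots,p\}$ for which a $t$-test of the null hypothesis $H_{0j}:\beta_j=0$ against the alternative hypothesis $H_{Aj}:\beta_j\ne0$ leads to acceptance of $H_{0j}$, and $K^*$ consists of the set of $j\in\{\ell+1,\dots,p\}$ for which a $t$-test of the null hypothesis $H_{0j}:\beta_j=0$ against the alternative hypothesis $H_{Aj}:\beta_j\neq 0$ leads to acceptance of $H_{0j}$. For each of these cases, the minimum coverage probability of the naive $1-\alpha$ confidence interval $I(\tilde K)$ is bounded above by the coverage probability of $I(K^* )$ for each given $\frac1\sigma(\beta_{\ell+1},\dots,\beta_p)\in\mathbb R^{p-\ell}$.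
   Context: Model: $Y=X\beta+\varepsilon$, where $X$ is a known $n\times p$ matrix with linearly independent columns, $n>p$, $\beta\in\mathbb R^p$ is an unknown parameter vector, $\varepsilon\sim N(0,\sigma^2I_n)$ and $\sigma^2>0$ is unknown. The quantity of interest is $\theta=a^T\beta$ with $a\in\mathbb R^p$, $a\ne0$, known. Fix $\alpha\in(0,1)$. All probabilities are under the true parameters $(\beta,\sigma)$; $n,p,X,a,\alpha$ are fixed. Let $\hat\beta$ be the least squares estimator of $\beta$ and $RSS=(Y-X\hat\beta)^T(Y-X\hat\beta)$. For $K\subset\{q+1,\dots,p\}$, $|K|$ is the number of elements of $K$; $\hat\beta_K$ is the least squares estimator of $\beta$ subject to the restriction $\beta_i=0$ for all $i\in K$ (so $\hat\beta_\emptyset=\hat\beta$); $RSS_K=(Y-X\hat\beta_K)^T(Y-X\hat\beta_K)$; $S_K^2=RSS_K/(n-p+|K|)$; and $v(K)=\mathrm{Var}(a^T\hat\beta_K)/\sigma^2$. Let $t(m)$ be defined by $P(-t(m)\le T\le t(m))=1-\alpha$ for $T$ having Student's $t$ distribution with $m$ degrees of freedom. Define $$I(K)=\big[a^T\hat\beta_K-d_K,\ a^T\hat\beta_K+d_K\big],\qquad d_K=t(n-p+|K|)\,S_K\sqrt{v(K)}.$$ For a data-dependent set $\tilde K$ (or $K^*$), $I(\tilde K)$ (or $I(K^* )$) is the interval $I(K)$ evaluated at the selected $K$; $I(\tilde K)$ is called the naive $1-\alpha$ confidence interval for $\theta$. The coverage probability of $I(\tilde K)$ is $P(\theta\in I(\tilde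 K))$, and its minimum coverage probability is the minimum (infimum) of this over the parameters $\beta\in\mathbb R^p$, $\sigma>0$. The coverage probability of $I(K^* )$ is $P(\theta\in I(K^* ))$; as background (a separate result, not part of this claim), it is a function of $\frac1\sigma(\beta_{\ell+1},\dots,\beta_p)$, which is why one may speak of its value for given $\frac1\sigma(\beta_{\ell+1},\dots,\beta_p)$. Criteria: $AIC(K)=n\ln(RSS_K)+2(p-|K|)f(n)$, where $f(n)=1$ for AIC and $f(n)=\frac12\ln n$ for BIC; $C_K=\dfrac{RSS_K}{RSS/(n-p)}-n+2(p-|K|)$ (Mallows' $C_P$); $B_K=\dfrac{RSS_K}{n-p+|K|}$ (minimizing $B_K$ is maximizing adjusted $R^2$). The $t$-test of $H_{0j}:\beta_j=0$ is the usual one, accepting $H_{0j}$ when $|T_j|$ is less than a fixed critical value, where $T_j=\hat\beta_j\big/\big(\sqrt{RSS/(n-p)}\sqrt{[(X^TX)^{-1}]_{jj}}\big)$; for a given $j$ the same test is used in defining $\tilde K$ and $K^*$. *)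

(* Defs.v *)
From HB Require Import structures.
From mathcomp Require Import all_boot all_order all_algebra.
From mathcomp Require Import all_classical all_reals all_analysis.

Set Implicit Arguments.
Unset Strict Implicit.
Unset Printing Implicit Defensive.

Import Order.TTheory GRing.Theory Num.Theory.
Import numFieldNormedType.Exports.

Local Open Scope classical_set_scope.
Local Open Scope ring_scope.

Section Student.
Context {R : realType}.

Definition Gamma_fun (x : R) : R :=
  Rintegral (@lebesgue_measure R) `]0, +oo[ (fun u => u `^ (x - 1) * expR (- u)).

Definition student_pdf (m : nat) (x : R) : R :=
  Gamma_fun (m.+1%:R / 2) / (Num.sqrt (m%:R * pi) * Gamma_fun (m%:R / 2)) *
  (1 + x ^+ 2 / m%:R) `^ (- (m.+1%:R / 2)).

(* [student_prob m A] is the probability that a variable with Student's t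
   distribution with [m] degrees of freedom ([0 < m]) lies in [A]. *)
Definition student_prob (m : nat) (A : set R) : \bar R :=
  (\int[@lebesgue_measure R]_(x in A) (student_pdf m x)%:E)%E.

End Student.

Section GaussianLinearModel.
Context {R : realType} {d : measure_display} {Omega : measurableType d}.

Definition mutually_independent (P : probability Omega R) (n : nat)
    (X : 'I_n -> Omega -> R) : Prop :=
  forall (J : {set 'I_n}) (B : 'I_n -> set R), (forall i, measurable (B i)) ->
    P [set w | forall i, i \in J -> B i (X i w)] =
    (\prod_(i in J) P (X i @^-1` B i))%E.

(* [eps] has distribution N(0, sigma^2 I_n) under [P]; the second parameter of
   [normal_prob] is the standard deviation. *)
Definition gaussian_noise (P : probability Omega R) (n : nat) (sigma : R)
    (eps : Omega -> 'cV[R]_n) : Prop :=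
  [/\ forall i, measurable_fun [set: Omega] (fun w => eps w i 0),
      forall i (B : set R), measurable B ->
        P [set w | B (eps w i 0)] = normal_prob 0 sigma B
    & mutually_independent P (fun i w => eps w i 0)].

(* [Pr beta sigma] is the probability under the true parameters
   (beta, sigma); [Y] is the response vector. *)
Definition gaussian_linear_model (n p : nat) (X : 'M[R]_(n, p))
    (Pr : 'cV[R]_p -> R -> probability Omega R) (Y : Omega -> 'cV[R]_n) : Prop :=
  forall beta sigma, 0 < sigma ->
    gaussian_noise (Pr beta sigma) sigma (fun w => Y w - X *m beta).

End GaussianLinearModel.

Section LeastSquares.
Context {R : realType} {n p : nat}.
Variable X : 'M[R]_(n, p).
Implicit Types (y : 'cV[R]_n) (b : 'cV[R]_p) (K F : {set 'I_p}).

Definition sum_sq y b : R := ((y - X *m b)^T *m (y - X *m b)) 0 0.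

Definition restricted K b : Prop := forall i, i \in K -> b i 0 = 0.

Definition is_lse K y b : Prop :=
  restricted K b /\ forall b', restricted K b' -> sum_sq y b <= sum_sq y b'.

(* Least squares estimator of beta subject to beta_i = 0 for all i in K; the
   minimizer exists and is unique when X has linearly independent columns. *)
Definition lse K y : 'cV[R]_p := xget 0 [set b | is_lse K y b].

Definition RSS K y : R := sum_sq y (lse K y).

Definition info_criterion (f : R) y K : R :=
  n%:R * ln (RSS K y) + 2 * (p - #|K|)%:R * f.

Definition mallows_Cp y K : R :=
  RSS K y / (RSS finset.set0 y / (n - p)%:R) - n%:R + 2 * (p - #|K|)%:R.

(* [mean_RSS y K] is S_K^2, and also the criterion B_K: minimizing it amounts
   to maximizing adjusted R^2. *)
Definition mean_RSS y K : R := RSS K y / (n - p + #|K|)%:R.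

Definition t_stat y (j : 'I_p) : R :=
  lse finset.set0 y j 0 /
  (Num.sqrt (RSS finset.set0 y / (n - p)%:R) * Num.sqrt (invmx (X^T *m X) j j)).

Definition minimizes (crit : {set 'I_p} -> R) F K : Prop :=
  K \subset F /\ forall K', K' \subset F -> crit K <= crit K'.

Variant selection_method := AIC | BIC | MallowsCp | AdjustedR2 | TTest.

(* [selects meth crit_val F y K]: on data y, method [meth] applied to the
   candidate indices [F] selects [K] as the set of coefficients put to zero;
   [crit_val j] is the critical value of the t-test of beta_j = 0. *)
Definition selects (meth : selection_method) (crit_val : 'I_p -> R) F y K : Prop :=
  match meth with
  | AIC => minimizes (info_criterion 1 y) F K
  | BIC => minimizes (info_criterion (ln n%:R / 2) y) F K
  | MallowsCp => minimizes (mallows_Cp y) F K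
  | AdjustedR2 => minimizes (mean_RSS y) F K
  | TTest => K = [set j in F | `|t_stat y j| < crit_val j]%SET
  end.

(* Ties between minimizers may be broken arbitrarily.  Nothing is required on
   the null event RSS = 0, where ln RSS, C_K and T_j are not defined. *)
Definition selection_rule (meth : selection_method) (crit_val : 'I_p -> R) F
    (Ksel : 'cV[R]_n -> {set 'I_p}) : Prop :=
  forall y, 0 < RSS finset.set0 y -> selects meth crit_val F y (Ksel y).

End LeastSquares.

(* Indices are 0-based: this is the set of 1-based indices {k+1, ..., p}. *)
Definition indices_after (p k : nat) : {set 'I_p} := [set i : 'I_p | (k <= i)%N]%SET.

Section Coverage.
Context {R : realType} {d : measure_display} {Omega : measurableType d}.
Context {n p : nat}.
Variables (X : 'M[R]_(n, p)) (a : 'cV[R]_p) (t : nat -> R).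
Variables (Pr : 'cV[R]_p -> R -> probability Omega R) (Y : Omega -> 'cV[R]_n).
Implicit Types (beta : 'cV[R]_p) (sigma : R) (K : {set 'I_p}).

Definition theta beta : R := (a^T *m beta) 0 0.

(* v(K) is defined under the true parameters, as a variance; it does not
   actually depend on them. *)
Definition v beta sigma K : R :=
  fine (variance (Pr beta sigma) (fun w => theta (lse X K (Y w)))) / sigma ^+ 2.

Definition half_width beta sigma K (y : 'cV[R]_n) : R :=
  t (n - p + #|K|)%N * Num.sqrt (mean_RSS X y K) * Num.sqrt (v beta sigma K).

Definition conf_interval beta sigma K (y : 'cV[R]_n) : interval R :=
  `[theta (lse X K y) - half_width beta sigma K y,
    theta (lse X K y) + half_width beta sigma K y].

Definition coverage (Ksel : 'cV[R]_n -> {set 'I_p}) beta sigma : \bar R :=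
  Pr beta sigma
    [set w | theta beta \in conf_interval beta sigma (Ksel (Y w)) (Y w)].

Definition min_coverage (Ksel : 'cV[R]_n -> {set 'I_p}) : \bar R :=
  ereal_inf [set r | exists beta sigma, 0 < sigma /\ r = coverage Ksel beta sigma].

End Coverage.

(* Main.v *)
Require Import Defs.
From HB Require Import structures.
From mathcomp Require Import all_boot all_order all_algebra.
From mathcomp Require Import all_classical all_reals all_analysis.
From mathcomp Require Import measurable_realfun ring lra.

(* Push the coefficients beta_{q+1}, ..., beta_l to infinity, keeping the others
   and sigma fixed.  If K contains one of the corresponding indices, RSS_K tends
   to infinity (respectively |T_j| does) for every value of the noise, so that
   eventually Ktilde only contains indices > l.  A minimizer over the large
   family which belongs to the small family is a minimizer over the small one,
   hence Ktilde is Kstar as soon as the latter is uniquely determined.  A tie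
   between two criteria forces a nontrivial quadratic form in Y to vanish, which
   has probability 0.  So the coverage of I(Ktilde) gets asymptotically below
   that of I(Kstar), and the latter did not change along the way: the data moved
   by a vector X c with c supported off the indices > l, and translating Y by
   such a vector only translates the restricted least squares estimators. *)

Set Implicit Arguments.
Unset Strict Implicit.
Unset Printing Implicit Defensive.

Import Order.TTheory GRing.Theory Num.Theory.
Import numFieldNormedType.Exports.

Local Open Scope classical_set_scope.
Local Open Scope ring_scope.

(** * Restricted least squares *)

Section SquaredNorm.
Context {R : realType}.

Definition sqn m (u : 'cV[R]_m) : R := (u^T *m u) 0 0.

Lemma sqnE m (u : 'cV[R]_m) : sqn u = \sum_i u i 0 ^+ 2.
Proof. by rewrite /sqn mxE; apply: eq_bigr => i _; rewrite mxE expr2. Qed.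

Lemma sqn_ge0 m (u : 'cV[R]_m) : 0 <= sqn u.
Proof. by rewrite sqnE sumr_ge0// => i _; rewrite sqr_ge0. Qed.

Lemma sqn_eq0 m (u : 'cV[R]_m) : (sqn u == 0) = (u == 0).
Proof.
apply/idP/eqP => [|->]; last by rewrite /sqn mulmx0 mxE.
rewrite sqnE psumr_eq0 => [/allP u0|i _]; last exact: sqr_ge0.
apply/colP => i; rewrite mxE; apply/eqP.
by rewrite -sqrf_eq0; apply: u0; rewrite mem_index_enum.
Qed.

Lemma sqn0 m : sqn (0 : 'cV[R]_m) = 0.
Proof. by apply/eqP; rewrite sqn_eq0. Qed.

Lemma sqnN m (u : 'cV[R]_m) : sqn (- u) = sqn u.
Proof. by rewrite !sqnE; apply: eq_bigr => i _; rewrite mxE sqrrN. Qed.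

Lemma sqn_ge_coord m (u : 'cV[R]_m) i : u i 0 ^+ 2 <= sqn u.
Proof.
by rewrite sqnE (bigD1 i)//= lerDl sumr_ge0// => j _; rewrite sqr_ge0.
Qed.

Lemma sqnD_orth m (u v : 'cV[R]_m) : v^T *m u = 0 -> sqn (u + v) = sqn u + sqn v.
Proof.
move=> vu; have uv : u^T *m v = 0 by rewrite -[u^T *m v]trmxK trmx_mul trmxK vu trmx0.
by rewrite /sqn [(u + v)^T]linearD/= mulmxDl !mulmxDr vu uv addr0 add0r mxE.
Qed.

(** A single coordinate where [w] is nonzero already makes the norm diverge along the line. *)
Lemma sqn_line_unbounded m (u w : 'cV[R]_m) (M : R) : w != 0 ->
  exists N : nat, forall s : nat, (N <= s)%N -> M < sqn (u + s%:R *: w).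
Proof.
move=> /eqP w0.
have [i wi] : exists i, w i 0 != 0.
  apply/existsP; rewrite -negb_forall; apply/negP => /forallP h.
  by apply: w0; apply/colP => i; rewrite mxE; apply/eqP.
(* This threshold forces the i-th coordinate above [|M| + 1] in absolute value; being at least 1, it
   is bounded by its own square. *)
exists (Num.bound ((`|u i 0| + `|M| + 1) / `|w i 0|)) => s sN.
apply: lt_le_trans (sqn_ge_coord _ i); rewrite !mxE.
have aw : 0 < `|w i 0| by rewrite normr_gt0.
have h : `|u i 0| + `|M| + 1 < s%:R * `|w i 0|.
  rewrite -ltr_pdivrMr//; apply: lt_le_trans (archi_boundP _) _.
    by rewrite divr_ge0// !addr_ge0.
  by rewrite ler_nat.
have {}h : `|M| + 1 < `|u i 0 + s%:R * w i 0|.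
  have := lerB_dist (s%:R * w i 0) (- u i 0).
  rewrite opprK normrN normrM (ger0_norm (ler0n _ _)) [_ + u i 0]addrC => h2.
  apply: lt_le_trans h2; rewrite ltrBrDl; apply: le_lt_trans h.
  by rewrite addrA.
rewrite -(real_normK (num_real (_ + _))).
apply: (@lt_le_trans _ _ (`|M| + 1)).
  by apply: le_lt_trans (ler_norm M) _; rewrite ltrDl.
rewrite expr2; apply: le_trans (ltW h) _.
by rewrite ler_peMr//; apply: le_trans (ltW h); rewrite lerDr.
Qed.

End SquaredNorm.

(** * Closed form and translation properties of restricted least squares *)

Section LeastSquaresTheory.
Context {R : realType} {n p : nat} (X : 'M[R]_(n, p)).
Hypothesis hX : row_free X^T.
Implicit Types (K F : {set 'I_p}) (y : 'cV[R]_n) (b c : 'cV[R]_p).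

Lemma design_inj b : X *m b = 0 -> b = 0.
Proof.
move=> Xb; apply/eqP; rewrite -trmx_eq0; apply/eqP.
by apply: (row_free_inj hX); rewrite mul0mx -trmx_mul Xb trmx0.
Qed.

Lemma restrictedB K b c : restricted K b -> restricted K c -> restricted K (b - c).
Proof. by move=> Kb Kc i iK; rewrite mxE [X in _ + X]mxE Kb// Kc// subrr. Qed.

(** Orthogonal projector onto the vectors that vanish on [K]; it turns the restriction into a
    fixed-point equation. *)
Definition keep_mx K : 'M[R]_p := diag_mx (\row_i (i \notin K)%:R).

Lemma keep_mxT K : (keep_mx K)^T = keep_mx K.
Proof. exact: tr_diag_mx. Qed.

Lemma keep_mx_coord K b i : (keep_mx K *m b) i 0 = (i \notin K)%:R * b i 0.
Proof. by rewrite mul_diag_mx !mxE. Qed.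

Lemma restrictedP K b : restricted K b <-> keep_mx K *m b = b.
Proof.
split=> [Kb|Kb i iK].
  apply/colP => i; rewrite keep_mx_coord.
  by case: (boolP (i \in K)) => [/Kb ->|_]; rewrite ?mulr0 ?mul1r.
by rewrite -Kb keep_mx_coord iK mul0r.
Qed.

Lemma keep_mx_restricted K b : restricted K (keep_mx K *m b).
Proof. by move=> i iK; rewrite keep_mx_coord iK mul0r. Qed.

Lemma keep_mx_idem K : keep_mx K *m keep_mx K = keep_mx K.
Proof.
apply/matrixP => i j; rewrite mul_diag_mx !mxE.
by case: (i \notin K); case: (i == j); rewrite ?mulr1n ?mulr0n ?mul1r ?mul0r.
Qed.

(* The Gram matrix of the kept columns, completed by the identity on [K] so as
   to be invertible. *)
Definition gram_mx K : 'M[R]_p :=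
  keep_mx K *m X^T *m X *m keep_mx K + (1%:M - keep_mx K).

(** For [v] in the left kernel, with [z] its transpose and [D] the projector, pairing with [z] gives
    |X D z|^2 + |z - D z|^2 = 0. Hence D z = 0 by injectivity of the design, and z = D z = 0. *)
Lemma gram_mx_unit K : gram_mx K \in unitmx.
Proof.
rewrite unitmxE unitfE; apply/negP => /det0P[v v0 vA].
set D := keep_mx K in vA; set z := v^T.
have e1 : v *m (D *m X^T *m X *m D) *m z = (X *m (D *m z))^T *m (X *m (D *m z)).
  by rewrite /z !trmx_mul keep_mxT trmxK !mulmxA.
have e2 : v *m (1%:M - D) *m z = (z - D *m z)^T *m (z - D *m z).
  rewrite /z [(_ - _)^T]linearB/= trmx_mul trmxK keep_mxT !mulmxBl !mulmxBr !mulmxBl.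
  rewrite mulmx1 !mulmxA; set w := v *m D *m v^T.
  suff -> : v *m D *m D *m v^T = w by rewrite subrr subr0.
  by rewrite -(mulmxA v) keep_mx_idem.
have : sqn (X *m (D *m z)) + sqn (z - D *m z) = 0.
  have := congr1 (fun w => (w *m z) 0 0) vA.
  by rewrite /gram_mx -/D mulmxDr mulmxDl e1 e2 mul0mx [LHS]mxE [RHS]mxE.
move/eqP; rewrite paddr_eq0 ?sqn_ge0// !sqn_eq0 => /andP[/eqP /design_inj ->].
by rewrite subr0 /z trmx_eq0 (negbTE v0).
Qed.

Definition lse_mx K : 'M[R]_(p, n) :=
  keep_mx K *m (invmx (gram_mx K) *m (keep_mx K *m X^T)).

Lemma lse_mx_restricted K y : restricted K (lse_mx K *m y).
Proof. by rewrite /lse_mx -mulmxA; exact: keep_mx_restricted. Qed.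

(** The residual is orthogonal to every kept column. *)
Lemma normal_equations K y : keep_mx K *m X^T *m (y - X *m (lse_mx K *m y)) = 0.
Proof.
set D := keep_mx K; set g := invmx (gram_mx K) *m (D *m X^T) *m y.
have Ag : gram_mx K *m g = D *m X^T *m y by rewrite /g -mulmxA mulKVmx// gram_mx_unit.
have Dg : D *m g = lse_mx K *m y by rewrite /lse_mx /g !mulmxA.
rewrite -Dg; clearbody g => {Dg}.
have zero : (1%:M - D) *m D = 0 by rewrite mulmxBl mul1mx keep_mx_idem subrr.
(* Multiplying by 1 - D kills the Gram part and leaves (1 - D) g = 0: the solution [g] of the
   completed system is already restricted. *)
have : (1%:M - D) *m gram_mx K *m g = 0 by rewrite -mulmxA Ag !mulmxA zero !mul0mx.
rewrite /gram_mx mulmxDr !mulmxA zero !mul0mx add0r mulmxBr mulmx1 zero subr0 => gD.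
rewrite mulmxBr -Ag /gram_mx mulmxDl gD addr0 !mulmxA.
by rewrite subrr.
Qed.

(** Pythagoras: the normal equations cancel the cross term. *)
Lemma sum_sq_lse K y c : restricted K c ->
  sum_sq X y (lse_mx K *m y + c) = sqn (y - X *m (lse_mx K *m y)) + sqn (X *m c).
Proof.
move=> /restrictedP Kc; rewrite /sum_sq mulmxDr opprD addrA.
rewrite -/(sqn _) (sqnD_orth (v := - (X *m c))) ?sqnN//.
rewrite -Kc [(- _)^T]linearN/= mulNmx !trmx_mul keep_mxT -(mulmxA _ _ X^T).
by rewrite -(mulmxA c^T) normal_equations mulmx0 oppr0.
Qed.

(** In the Pythagorean decomposition the second term vanishes only at the closed form, since the
    design is injective. *)
Lemma is_lseP K y b : is_lse X K y b <-> b = lse_mx K *m y.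
Proof.
have Kl := @lse_mx_restricted K y.
have sq b' : restricted K b' -> sum_sq X y b' =
    sqn (y - X *m (lse_mx K *m y)) + sqn (X *m (b' - lse_mx K *m y)).
  by move=> Kb'; rewrite -sum_sq_lse ?subrKC//; exact: restrictedB.
split=> [[Kb /(_ _ Kl)]|->].
  rewrite !sq// subrr mulmx0 sqn0 lerD2l => sq0.
  apply/eqP; rewrite -subr_eq0; apply/eqP/design_inj/eqP.
  by rewrite -sqn_eq0 eq_le sq0 sqn_ge0.
by split=> // b' Kb'; rewrite !sq// subrr mulmx0 sqn0 lerD2l sqn_ge0.
Qed.

Lemma lseE K y : lse X K y = lse_mx K *m y.
Proof.
by apply/is_lseP; rewrite /lse; apply: xgetPex; exists (lse_mx K *m y); apply/is_lseP.
Qed.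

Definition res_mx K : 'M[R]_n := 1%:M - X *m lse_mx K.

Lemma RSSE K y : RSS X K y = sqn (res_mx K *m y).
Proof. by rewrite /RSS /sum_sq lseE /sqn /res_mx mulmxBl mul1mx mulmxA. Qed.

Lemma RSS_ge0 K y : 0 <= RSS X K y.
Proof. by rewrite RSSE sqn_ge0. Qed.

(** Moving the data by X c amounts to replacing [b] by b - c in the objective, and this substitution
    preserves the restriction. *)
Lemma lse_shift K y c : restricted K c -> lse X K (y + X *m c) = lse X K y + c.
Proof.
move=> Kc; rewrite lseE; apply/esym/is_lseP; have [Kl lmin] : is_lse X K y (lse X K y).
  by apply/is_lseP; rewrite lseE.
have sh b : sum_sq X (y + X *m c) b = sum_sq X y (b - c).
  by rewrite /sum_sq [X *m (b - c)]mulmxBr opprB addrA.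
split=> [i iK|b Kb]; first by rewrite mxE Kl// Kc// addr0.
by rewrite !sh addrK; apply: lmin; exact: restrictedB.
Qed.

Lemma RSS_shift K y c : restricted K c -> RSS X K (y + X *m c) = RSS X K y.
Proof.
by move=> Kc; rewrite /RSS lse_shift// /sum_sq [X *m (_ + _)]mulmxDr opprD addrACA subrr addr0.
Qed.

Lemma RSS_design_eq0 K b : RSS X K (X *m b) = 0 <-> restricted K b.
Proof.
split=> [|Kb]; last by rewrite -[X *m b]add0r RSS_shift// RSSE mulmx0 sqn0.
move/eqP; rewrite RSSE sqn_eq0 /res_mx mulmxBl mul1mx -mulmxA -mulmxBr => /eqP.
by move=> /design_inj/eqP; rewrite subr_eq0 => /eqP ->; exact: lse_mx_restricted.
Qed.

Lemma RSS_set0_le K y : RSS X finset.set0 y <= RSS X K y.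
Proof.
have [_] : is_lse X finset.set0 y (lse X finset.set0 y) by apply/is_lseP; rewrite lseE.
by apply=> i; rewrite inE.
Qed.

Lemma RSS_unbounded K y c (M : R) : ~ restricted K c ->
  exists N : nat, forall s : nat, (N <= s)%N -> M < RSS X K (y + s%:R *: (X *m c)).
Proof.
move=> Kc; have w0 : res_mx K *m (X *m c) != 0.
  by apply/eqP => w0; apply: Kc; apply/RSS_design_eq0; rewrite RSSE w0 sqn0.
have [N HN] := sqn_line_unbounded (res_mx K *m y) M w0.
by exists N => s /HN; rewrite RSSE mulmxDr -scalemxAr.
Qed.

(** Since p < n, some nonzero vector is orthogonal to all columns, and it is its own residual. *)
Lemma RSS_set0_neq0 : (p < n)%N -> exists y, RSS X finset.set0 y != 0.
Proof.
move=> pn; have : kermx X != 0.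
  rewrite kermx_eq0 /row_free; apply/eqP => rX.
  by have := rank_leq_col X; rewrite rX leqNgt pn.
move/rowV0Pn => [u /sub_kermxP uX u0]; exists u^T.
have Xu : X^T *m u^T = 0 by rewrite -trmx_mul uX trmx0.
rewrite RSSE /res_mx /lse_mx mulmxBl mul1mx -!mulmxA Xu !mulmx0 subr0.
by rewrite sqn_eq0 trmx_eq0.
Qed.

(** The entry is |X z|^2 for [z] the j-th column of the inverse Gram matrix; this makes the
    denominator of the t statistic positive when RSS is. *)
Lemma diag_gram_inv_gt0 j : 0 < invmx (X^T *m X) j j.
Proof.
have G : X^T *m X \in unitmx.
  rewrite unitmxE unitfE; apply/negP => /det0P[v v0 vA].
  have : sqn (X *m v^T) == 0.
    by rewrite /sqn trmx_mul trmxK -mulmxA (mulmxA X^T) mulmxA vA mul0mx mxE.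
  by rewrite sqn_eq0 => /eqP/design_inj/eqP; rewrite trmx_eq0 (negbTE v0).
set e : 'cV[R]_p := delta_mx j 0; set z := invmx (X^T *m X) *m e.
have -> : invmx (X^T *m X) j j = sqn (X *m z).
  have -> : sqn (X *m z) = (z^T *m e) 0 0.
    by rewrite /sqn trmx_mul -mulmxA (mulmxA X^T) /z mulKVmx.
  rewrite /z trmx_mul trmx_inv trmx_mul trmxK -mulmxA.
  rewrite /e trmx_delta -rowE mxE -colE mxE.
  by [].
rewrite lt_neqAle sqn_ge0 andbT eq_sym sqn_eq0; apply/eqP => /design_inj z0.
have : e j 0 = 0 by rewrite -[e](mulKVmx G) -/z z0 mulmx0 mxE.
by rewrite mxE !eqxx/= => /eqP; rewrite oner_eq0.
Qed.

End LeastSquaresTheory.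

(** * Selection methods *)

Section Selection.
Context {R : realType} {n p : nat} (X : 'M[R]_(n, p)).
Hypothesis hX : row_free X^T.
Hypothesis hpn : (p < n)%N.
Variables (meth : selection_method) (crit_val : 'I_p -> R).
Implicit Types (K F : {set 'I_p}) (y : 'cV[R]_n) (b c : 'cV[R]_p).

Local Notation RSS0 := (RSS X finset.set0).
Local Notation sel := (selects X meth crit_val).

Lemma df_gt0 k : 0 < (n - p + k)%:R :> R.
Proof. by rewrite ltr0n ltn_addr// subn_gt0. Qed.

Lemma minimizes_crit_eq (crit : {set 'I_p} -> R) F K K' :
  minimizes crit F K -> minimizes crit F K' -> crit K = crit K'.
Proof. by move=> [KF h] [KF' h']; apply/eqP; rewrite eq_le h// h'. Qed.

Lemma info_criterion_tie f y K K' : 0 < RSS0 y ->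
  info_criterion X f y K = info_criterion X f y K' ->
  RSS X K y =
    expR ((2 * (p - #|K'|)%:R * f - 2 * (p - #|K|)%:R * f) / n%:R) * RSS X K' y.
Proof.
move=> y0; have RK (L : {set 'I_p}) : 0 < RSS X L y.
  exact: lt_le_trans y0 (RSS_set0_le hX _ _).
have n0 : n%:R != 0 :> R by rewrite pnatr_eq0 -lt0n (leq_trans _ hpn).
rewrite /info_criterion => e.
rewrite -{1}[RSS X K y]lnK ?posrE// -[in RHS](@lnK _ (RSS X K' y)) ?posrE// -expRD.
congr expR; apply: (mulfI n0).
by rewrite mulrDr mulrCA divff// mulr1; lra.
Qed.

(** Every kind of tie becomes one linear relation between residual sums of squares. Logarithms are
    exponentiated, and only Mallows' criterion needs a nonzero [e]; a t-test determines its set, so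
    there any constants do. *)
Lemma selects_tie F K K' : K != K' -> exists c e : R, 0 < c /\
  forall y, 0 < RSS0 y -> sel F y K -> sel F y K' ->
    RSS X K y = c * RSS X K' y + e * RSS0 y.
Proof.
move=> KK'; case: meth => /=.
- exists (expR ((2 * (p - #|K'|)%:R * 1 - 2 * (p - #|K|)%:R * 1) / n%:R)), 0.
  split=> [|y y0 m m']; first exact: expR_gt0.
  by rewrite mul0r addr0; apply: info_criterion_tie => //; apply: minimizes_crit_eq m m'.
- exists (expR ((2 * (p - #|K'|)%:R * (ln n%:R / 2)
    - 2 * (p - #|K|)%:R * (ln n%:R / 2)) / n%:R)), 0.
  split=> [|y y0 m m']; first exact: expR_gt0.
  by rewrite mul0r addr0; apply: info_criterion_tie => //; apply: minimizes_crit_eq m m'.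
- exists 1, ((2 * (p - #|K'|)%:R - 2 * (p - #|K|)%:R) / (n - p)%:R); split=> // y y0 m m'.
  have := minimizes_crit_eq m m'; rewrite /mallows_Cp.
  have n0 : (n - p)%:R != 0 :> R by rewrite gt_eqF// -[(n - p)%N]addn0 df_gt0.
  have y1 : RSS0 y != 0 by rewrite gt_eqF.
  move: ((n - p)%:R : R) n0 ((p - #|K|)%:R : R) ((p - #|K'|)%:R : R) (n%:R : R).
  move: (RSS0 y) y1 (RSS X K y) (RSS X K' y) => r0 y1 r r' A n0 D D' B e.
  have {}e : r / (r0 / A) = r' / (r0 / A) + 2 * D' - 2 * D by lra.
  have r0A : r0 / A != 0 by rewrite mulf_neq0// invr_neq0.
  apply: (mulIf (invr_neq0 r0A)); rewrite e; field.
  by rewrite n0 y1.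
- exists ((n - p + #|K|)%:R / (n - p + #|K'|)%:R), 0.
  split=> [|y y0 m m']; first by rewrite divr_gt0// df_gt0.
  have := minimizes_crit_eq m m'; rewrite /mean_RSS => e.
  have n0 k : (n - p + k)%:R != 0 :> R by rewrite gt_eqF// df_gt0.
  apply: (mulIf (invr_neq0 (n0 #|K|))); rewrite e; field.
  by rewrite -!natrD !n0.
- by exists 1, 0; split=> // y y0 m; rewrite -m => /eqP; rewrite eq_sym (negbTE KK').
Qed.

(** The witness is X e_i, with e_i a unit vector and [i] in exactly one of the two sets. The
    unrestricted RSS vanishes there, and so does exactly one of RSS_K and RSS_K'. *)
Lemma RSS_tie_nontrivial K K' (c e : R) : K != K' -> 0 < c ->
  exists y, RSS X K y - c * RSS X K' y - e * RSS0 y != 0.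
Proof.
move=> KK' c0.
have [i] : exists i, (i \in K) != (i \in K').
  apply/existsP; rewrite -negb_forall; apply: contra KK' => /forallP h.
  by apply/eqP/setP => i; apply/eqP.
have rst (L : {set 'I_p}) : restricted L (delta_mx i 0 : 'cV[R]_p) <-> i \notin L.
  split=> [h|iL j jL]; last by rewrite mxE andbT; case: eqP => // ji; rewrite -ji jL in iL.
  by apply/negP => /h; rewrite mxE !eqxx/= => /eqP; rewrite oner_eq0.
have r0 : RSS0 (X *m delta_mx i 0) = 0 by apply/RSS_design_eq0/rst => //; rewrite inE.
move=> iKK'; exists (X *m delta_mx i 0); rewrite r0 mulr0 subr0.
have [iK|iK] := boolP (i \in K).
  have -> : RSS X K' (X *m delta_mx i 0) = 0.
    by apply/RSS_design_eq0/rst => //; rewrite iK in iKK'; case: (i \in K') iKK'.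
  by rewrite mulr0 subr0; apply/eqP => /(RSS_design_eq0 hX)/rst; rewrite iK.
have -> : RSS X K (X *m delta_mx i 0) = 0 by apply/RSS_design_eq0/rst.
rewrite sub0r oppr_eq0 mulf_eq0 gt_eqF//=.
apply/eqP => /(RSS_design_eq0 hX)/rst.
by move: iKK'; rewrite (negbTE iK); case: (i \in K').
Qed.

Lemma selects_subset F y K : sel F y K -> K \subset F.
Proof.
by case: meth => /= [[]|[]|[]|[]|->]//; apply/fintype.subsetP => i; rewrite inE => /andP[].
Qed.

(** A minimizer lying in a subfamily is minimal there. For t-tests, acceptance of an index does not
    depend on the candidate family. *)
Lemma selects_sub F F' y K : F' \subset F -> K \subset F' -> sel F y K -> sel F' y K.
Proof.
move=> FF' KF'.
have mini crit : minimizes crit F K -> minimizes crit F' K.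
  by move=> [_ h]; split=> // L LF'; apply: h; exact: fintype.subset_trans FF'.
case: meth => /=; [exact: mini|exact: mini|exact: mini|exact: mini|].
move=> KE; apply/setP => j; move/setP/(_ j): KE; move/fintype.subsetP/(_ j): KF'.
move/fintype.subsetP/(_ j): FF'; rewrite !inE.
case: (j \in F'); case: (j \in F); case: (j \in K) => //= a b; by [have := a isT | have := b isT].
Qed.

Lemma restricted_subset K K' c : K \subset K' -> restricted K' c -> restricted K c.
Proof. by move=> /fintype.subsetP KK' h i /KK' /h. Qed.

(** All competing sets lie in [F], where [c] vanishes, so each RSS is unchanged; the t statistics
    with index in [F] are unchanged as well. *)
Lemma selects_shift F y c K : K \subset F -> restricted F c ->
  sel F y K -> sel F (y + X *m c) K.
Proof.
move=> KF Fc.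
have R0 (L : {set 'I_p}) : L \subset F -> RSS X L (y + X *m c) = RSS X L y.
  by move=> LF; apply: RSS_shift => //; exact: restricted_subset Fc.
have mini (crit : 'cV[R]_n -> {set 'I_p} -> R) :
    (forall L : {set 'I_p}, L \subset F -> crit (y + X *m c) L = crit y L) ->
    minimizes (crit y) F K -> minimizes (crit (y + X *m c)) F K.
  by move=> h [_ m]; split=> // L LF; rewrite !h//; exact: m.
case: meth => /=.
- by apply: (mini (info_criterion X _)) => L LF; rewrite /info_criterion R0.
- by apply: (mini (info_criterion X _)) => L LF; rewrite /info_criterion R0.
- by apply: (mini (mallows_Cp X)) => L LF; rewrite /mallows_Cp !R0// finset.sub0set.
- by apply: (mini (mean_RSS X)) => L LF; rewrite /mean_RSS R0.
- have lse0 : lse X finset.set0 (y + X *m c) = lse X finset.set0 y + c.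
    by apply: lse_shift => // i; rewrite inE.
  move=> ->; apply: eq_finset => j; apply: andb_id2l => jF.
  by rewrite /t_stat (R0 _ (finset.sub0set F)) lse0 mxE Fc// addr0.
Qed.

(* Along [s] the competing criterion values blow up, while everything that is
   computed from [RSS0] only stays put. *)
Lemma selects_eventually F F' y c : 0 < RSS0 y ->
  (forall i, i \in F -> i \notin F' -> c i 0 != 0) ->
  exists N : nat, forall s, (N <= s)%N ->
    forall K, sel F (y + s%:R *: (X *m c)) K -> K \subset F'.
Proof.
move=> y0 Fc.
have R0 s : RSS0 (y + s%:R *: (X *m c)) = RSS0 y.
  by rewrite scalemxAr RSS_shift// => i; rewrite inE.
suff h K : exists N : nat, forall s, (N <= s)%N ->
    sel F (y + s%:R *: (X *m c)) K -> K \subset F'.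
  (* The maximum over the finitely many [K] serves them all; the default 0 is never taken, since [h]
     provides a threshold for each [K]. *)
  exists (\max_K xget 0%N [set N : nat | forall s, (N <= s)%N ->
    sel F (y + s%:R *: (X *m c)) K -> K \subset F']) => s Ns K.
  have := h K => /(xgetPex 0%N); apply.
  by apply: leq_trans Ns; exact: leq_bigmax.
have [KF'|KF'] := boolP (K \subset F'); first by exists 0%N.
have [KF|KF] := boolP (K \subset F); last first.
  by exists 0%N => s _ /selects_subset KF2; rewrite KF2 in KF.
have [j jK jF'] := fintype.subsetPn KF'; have cj := Fc _ (fintype.subsetP KF _ jK) jF'.
have nKc : ~ restricted K c by move=> /(_ _ jK)/eqP; rewrite (negbTE cj).
have n0 : 0 < n%:R :> R by rewrite ltr0n (leq_trans _ hpn).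
(* With [K] not inside [F'], the goal has become [false]: for large [s], the empty set must beat [K]
   in each criterion, or the test at [j] must reject. *)
have info f : exists N : nat, forall s, (N <= s)%N ->
    minimizes (info_criterion X f (y + s%:R *: (X *m c))) F K -> false.
  (* The criterion at the empty set, constant in [s]. The threshold put on RSS_K is the value at
     which the criterion of [K] equals [M]. *)
  pose M : R := n%:R * ln (RSS0 y) + 2 * (p - #|@finset.set0 'I_p|)%:R * f.
  have [N HN] := RSS_unbounded hX y (expR ((M - 2 * (p - #|K|)%:R * f) / n%:R)) nKc.
  exists N => s /HN h [_ /(_ _ (finset.sub0set _))]; rewrite /info_criterion R0 -/M => h2.
  exfalso; move: h; apply/negP; rewrite -leNgt -ler_ln ?posrE ?expR_gt0//; last first.
    by apply: lt_le_trans y0 _; rewrite -(R0 s); exact: RSS_set0_le.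
  by rewrite expRK ler_pdivlMr// mulrC; lra.
case: meth => /=; [exact: info|exact: info| | |].
- pose A := RSS0 y / (n - p)%:R; have A0 : 0 < A.
    by rewrite divr_gt0// -[(n - p)%N]addn0 df_gt0.
  pose B k : R := 2 * (p - k)%:R.
  have [N HN] := RSS_unbounded hX y
    ((RSS0 y / A + B #|@finset.set0 'I_p| - B #|K|) * A) nKc.
  exists N => s /HN h [_ /(_ _ (finset.sub0set _))]; rewrite /mallows_Cp !R0 -/A => h2.
  exfalso; move: h; apply/negP; rewrite -leNgt -ler_pdivrMr//; move: h2.
  by rewrite -!/(B _) addrAC [leRHS]addrAC lerD2r lerBrDr.
- have [N HN] := RSS_unbounded hX y
    (RSS0 y / (n - p + #|@finset.set0 'I_p|)%:R * (n - p + #|K|)%:R) nKc.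
  exists N => s /HN h [_ /(_ _ (finset.sub0set _))]; rewrite /mean_RSS R0 => h2.
  by exfalso; move: h; apply/negP; rewrite -leNgt -ler_pdivrMr ?df_gt0.
- pose A := Num.sqrt (RSS0 y / (n - p)%:R) * Num.sqrt (invmx (X^T *m X) j j).
  have A0 : 0 < A.
    rewrite mulr_gt0// sqrtr_gt0 ?diag_gram_inv_gt0//.
    by rewrite divr_gt0// -[(n - p)%N]addn0 df_gt0.
  (* The j-th estimate moves along a line of slope [c j 0] while the denominator [A] stays fixed; it
     is read as a vector of length 1 to apply the norm lemma. *)
  have [N HN] := sqn_line_unbounded (const_mx (lse X finset.set0 y j 0) : 'cV[R]_1)
     ((crit_val j * A) ^+ 2) (w := const_mx (c j 0)) ltac:(by
       apply: contra cj => /eqP/colP/(_ 0); rewrite !mxE => ->).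
  exists N => s /HN; rewrite sqnE big_ord1 !mxE => h /setP/(_ j); rewrite jK inE /t_stat R0 -/A.
  have -> : lse X finset.set0 (y + s%:R *: (X *m c)) = lse X finset.set0 y + s%:R *: c.
    by rewrite scalemxAr; apply: lse_shift => // i; rewrite inE.
  move=> /esym/andP[_].
  rewrite !mxE normrM normfV (gtr0_norm A0) ltr_pdivrMr// => h2.
  exfalso; move: h; apply/negP; rewrite -leNgt -(real_normK (num_real (_ + _))).
  by rewrite ler_sqr ?nnegrE// ltW// (le_lt_trans _ h2).
Qed.

End Selection.

(** * Gaussian vectors *)

Section BorelVectors.
Context {R : realType} {n : nat}.

Definition box (B : 'I_n -> set R) : set 'cV[R]_n := [set x | forall i, B i (x i 0)].

Definition boxes : set (set 'cV[R]_n) :=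
  [set box B | B in [set B : 'I_n -> set R | forall i, measurable (B i)]].

Definition borel_vec := g_sigma_algebraType boxes.

Lemma boxes_setI : setI_closed boxes.
Proof.
move=> _ _ [B mB <-] [C mC <-]; exists (fun i => B i `&` C i).
  by move=> i; exact: measurableI.
apply/seteqP; split=> x /=; first by move=> h; split=> i; have [] := h i.
by move=> [h h'] i; split.
Qed.

Lemma measurable_box (B : 'I_n -> set R) : (forall i, measurable (B i)) ->
  measurable (box B : set borel_vec).
Proof. by move=> mB; apply: sub_sigma_algebra; exists B. Qed.

Lemma measurable_coord i :
  measurable_fun setT (fun x : borel_vec => (x : 'cV[R]_n) i 0).
Proof.
move=> _ A mA; rewrite setTI.
have -> : (fun x : borel_vec => (x : 'cV[R]_n) i 0) @^-1` A =
    box (fun j => if j == i then A else setT).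
  apply/seteqP; split=> x /= h; last by have := h i; rewrite eqxx.
  by move=> j; case: eqP => // ->.
by apply: measurable_box => j; case: eqP.
Qed.

Lemma measurable_to_vec d (T : measurableType d) (f : T -> borel_vec) :
  (forall i, measurable_fun setT (fun t => (f t : 'cV[R]_n) i 0)) ->
  measurable_fun setT f.
Proof.
move=> mf; apply: (@measurability _ _ T borel_vec setT f boxes) => //.
move=> _ [_ [B mB <-] <-]; rewrite setTI.
have -> : f @^-1` box B =
    \bigcap_(i in setT) ((fun t => (f t : 'cV[R]_n) i 0) @^-1` B i).
  by apply/seteqP; split=> t /= h i; [move=> _|]; exact: h.
apply: fin_bigcap_measurable => // i _; rewrite -[X in measurable X]setTI.
exact: mf.
Qed.

(** Boxes are closed under intersection and generate the sigma-algebra, so the uniqueness theorem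
    for finite measures applies. *)
Lemma measure_vec_unique (m1 m2 : probability borel_vec R) :
  (forall B : 'I_n -> set R, (forall i, measurable (B i)) -> m1 (box B) = m2 (box B)) ->
  forall A, measurable A -> m1 A = m2 A.
Proof.
move=> h A mA; apply: (@measure_unique _ R borel_vec boxes (fun=> setT)) => //.
- exact: boxes_setI.
- move=> _; exists (fun=> setT) => //; by apply/seteqP; split.
- by rewrite bigcup_const//; exists 0%N.
- by move=> _ [B mB <-]; exact: h.
- by move=> _; rewrite -ge0_fin_numE// fin_num_measure.
Qed.

(** The law N(0, s^2 I_n), specified on boxes only, which determines it. *)
Definition gaussian_law (s : R) (m : probability borel_vec R) : Prop :=
  forall B : 'I_n -> set R, (forall i, measurable (B i)) ->
    m (box B) = (\prod_i normal_prob 0 s (B i))%E.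

End BorelVectors.
Arguments borel_vec R n : clear implicits.

(** * Measurability of sets defined by comparisons *)

Section MeasurableSets.
Context {d} {T : measurableType d} {R : realType}.
Implicit Types (f g : T -> R).

Lemma measurable_bool (b : T -> bool) : measurable_fun setT b -> measurable [set x | b x].
Proof. by move=> mb; rewrite -[X in measurable X]setTI; exact: mb. Qed.

Lemma measurable_eq_set f g : measurable_fun setT f -> measurable_fun setT g ->
  measurable [set x | f x = g x].
Proof.
move=> mf mg; rewrite (_ : [set x | _] = [set x | f x == g x]).
  exact/measurable_bool/measurable_fun_eqr.
by apply/seteqP; split=> x /= /eqP.
Qed.

Lemma measurable_le_set f g : measurable_fun setT f -> measurable_fun setT g ->
  measurable [set x | f x <= g x].
Proof. by move=> mf mg; exact/measurable_bool/measurable_fun_ler. Qed.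

Lemma measurable_lt_set f g : measurable_fun setT f -> measurable_fun setT g ->
  measurable [set x | f x < g x].
Proof. by move=> mf mg; exact/measurable_bool/measurable_fun_ltr. Qed.

End MeasurableSets.

(** * Image of a probability under a measurable map *)

Section ImageLaw.
Context {d d'} {T : measurableType d} {U : measurableType d'} {R : realType}.

Definition image_law (P : probability T R) (f : T -> U)
    (mf : measurable_fun setT f) : probability U R :=
  distribution P (HB.pack f (isMeasurableFun.Build _ _ _ _ f mf)).

Lemma image_lawE (P : probability T R) (f : T -> U) (mf : measurable_fun setT f) A :
  image_law P mf A = P (f @^-1` A).
Proof. by []. Qed.

Lemma ge0_integral_image_law (P : probability T R) (f : T -> U)
    (mf : measurable_fun setT f) (h : U -> \bar R) :
  measurable_fun setT h -> (forall y, 0 <= h y)%E ->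
  (\int[image_law P mf]_y h y = \int[P]_x h (f x))%E.
Proof. exact: ge0_integral_distribution. Qed.

Lemma integral_image_law (P : probability T R) (f : T -> U)
    (mf : measurable_fun setT f) (h : U -> \bar R) :
  measurable_fun setT h -> P.-integrable setT (h \o f) ->
  (\int[image_law P mf]_y h y = \int[P]_x h (f x))%E.
Proof. by move=> mh ih; rewrite [LHS]integral_pushforward. Qed.

End ImageLaw.

(** * Null sets and integrability for Gaussian vectors *)

Section GaussianVector.
Context {R : realType} {n : nat}.
Local Notation V := (borel_vec R n).
Implicit Types (s : R) (m : probability V R).

Definition set_coord (i : 'I_n) (x : 'cV[R]_n) (t : R) : 'cV[R]_n :=
  \col_j (if j == i then t else x j 0).

Lemma set_coordE i x t : set_coord i x t = set_coord i x 0 + t *: delta_mx i 0.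
Proof.
apply/colP => j; rewrite !mxE; case: eqP => _ /=; rewrite ?mulr1 ?add0r//.
by rewrite mulr0 addr0.
Qed.

Lemma measurable_set_coord i :
  measurable_fun setT (fun xt : V * measurableTypeR R => set_coord i xt.1 xt.2 : V).
Proof.
apply: measurable_to_vec => j; have [->|ji] := eqVneq j i.
  by under eq_fun do rewrite mxE eqxx; exact: measurable_snd.
under eq_fun do rewrite mxE (negbTE ji).
exact: (measurableT_comp (measurable_coord j) measurable_fst).
Qed.

(* Resampling one coordinate independently leaves the law unchanged. *)
Lemma gaussian_law_section s m i (A : set V) : gaussian_law s m -> measurable A ->
  (forall x, countable [set t | A (set_coord i x t)]) -> m A = 0%E.
Proof.
move=> gm mA cA.
pose N : probability (measurableTypeR R) R := normal_prob 0 s.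
have NT : normal_prob 0 s [set: R] = 1%E := probability_setT N.
have -> : m A = image_law (m \x N)%E (measurable_set_coord i) A.
  apply: measure_vec_unique => // B mB.
  rewrite [RHS]image_lawE; apply: (etrans (gm B mB)).
  (* [B'] frees coordinate [i] of the old vector; the constraint [B i] is carried by the fresh
     normal variable. *)
  pose B' j := if j == i then setT else B j.
  have mB' j : measurable (B' j) by rewrite /B'; case: eqP.
  transitivity ((m \x N)%E (box B' `*` B i)).
    rewrite [RHS](product_measure1E m N (measurable_box mB') (mB i)).
    transitivity ((\prod_j normal_prob 0 s (B' j)) * normal_prob 0 s (B i))%E; last first.
      by rewrite -(gm B' mB').
    rewrite (bigD1 i)//= [in RHS](bigD1 i)//= {1}/B' eqxx NT mul1e muleC.
    by congr (_ * _)%E; apply: eq_bigr => j ji; rewrite /B' (negbTE ji).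
  congr ((_ \x _)%E _); apply/seteqP; split=> [[x t] /= [xB tB] j|[x t] /= h].
    by rewrite mxE; case: eqP => [->//|/eqP ji]; have := xB j; rewrite /B' (negbTE ji).
  split=> [j|]; last by have := h i; rewrite mxE eqxx.
  by rewrite /B'; case: eqP => // /eqP ji; have := h j; rewrite mxE (negbTE ji).
(* The product measure integrates the measures of the sections, which are countable, hence null for
   the absolutely continuous normal law. *)
rewrite [LHS]image_lawE; apply: integral0_eq => x _ /=.
have mS : measurable (xsection ((fun xt : V * measurableTypeR R =>
    set_coord i xt.1 xt.2 : V) @^-1` A) x).
  apply: measurable_xsection; rewrite -[X in measurable X]setTI.
  exact: (measurable_set_coord i).
have /null_content_dominatesP dom := normal_prob_dominates 0 s.
apply: dom => //; apply: countable_lebesgue_measure0.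
apply: sub_countable (cA x); apply: subset_card_le => t.
by rewrite /xsection/= inE.
Qed.

Lemma quadratic_roots_countable (a b c : R) : a != 0 \/ b != 0 ->
  countable [set t | a * t ^+ 2 + b * t + c = 0].
Proof.
move=> ab; have [[t0 r0]|/forallNP e] := pselect (exists t, a * t ^+ 2 + b * t + c = 0).
  (* Given a root [t0], factoring out t - t0 leaves a (t + t0) + b = 0 for any other root; such a
     root forces [a] to be nonzero. *)
  apply: (@sub_countable _ _ _ [set t0; - (b / a) - t0]).
    apply: subset_card_le => t /= rt.
    have [->|tt0] := eqVneq t t0; [by left|right].
    have {}rt : a * (t + t0) + b = 0.
      have tt : t - t0 != 0 by rewrite subr_eq0.
      apply: (mulfI tt); rewrite mulr0.
      have -> : (t - t0) * (a * (t + t0) + b) =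
        (a * t ^+ 2 + b * t + c) - (a * t0 ^+ 2 + b * t0 + c) by ring.
      by rewrite rt r0 subrr.
    have a0 : a != 0.
      by case: ab => // b0; apply: contraNN b0 => /eqP a0; move: rt; rewrite a0 mul0r add0r => ->.
    have -> : t = (a * (t + t0) + b) / a - b / a - t0 by field.
    by rewrite rt mul0r sub0r.
  exact/finite_set_countable.
have -> : [set t | a * t ^+ 2 + b * t + c = 0] = set0 by apply/seteqP; split=> // t /e.
exact: countable0.
Qed.

Definition quad (Q : 'M[R]_n) (u : 'cV[R]_n) : R := (u^T *m Q *m u) 0 0.

Lemma quadE Q u : quad Q u = \sum_k u k 0 * (Q *m u) k 0.
Proof. by rewrite /quad -mulmxA mxE; apply: eq_bigr => k _; rewrite mxE. Qed.

Lemma quad_lincomb Q1 Q2 Q3 (b c : R) u :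
  quad (Q1 - b *: Q2 - c *: Q3) u = quad Q1 u - b * quad Q2 u - c * quad Q3 u.
Proof.
have quadB Q Q' : quad (Q - Q') u = quad Q u - quad Q' u.
  by rewrite /quad mulmxBr mulmxBl [LHS]mxE; congr (_ + _); rewrite mxE.
have quadZ k Q : quad (k *: Q) u = k * quad Q u.
  by rewrite /quad -scalemxAr -scalemxAl mxE.
by rewrite !quadB !quadZ.
Qed.

Lemma mulmx_line k (M : 'M[R]_(k, n)) (z : 'cV[R]_n) i t j :
  (M *m (z + t *: delta_mx i 0)) j 0 = (M *m z) j 0 + t * M j i.
Proof. by rewrite mulmxDr -scalemxAr -colE !mxE. Qed.

Lemma quad_line Q z i t : quad Q (z + t *: delta_mx i 0) =
  Q i i * t ^+ 2 + ((Q + Q^T) *m z) i 0 * t + quad Q z.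
Proof.
rewrite !quadE.
have -> : ((Q + Q^T) *m z) i 0 = (Q *m z) i 0 + \sum_k z k 0 * Q k i.
  rewrite mulmxDl mxE; congr (_ + _); rewrite mxE.
  by apply: eq_bigr => k _; rewrite mxE mulrC.
transitivity (\sum_k (z k 0 * (Q *m z) k 0 + t * (z k 0 * Q k i)) +
    \sum_k (k == i)%:R * (t * (Q *m z) k 0 + t ^+ 2 * Q k i)).
  rewrite -big_split/=; apply: eq_bigr => k _; rewrite mulmx_line !mxE andbT; ring.
rewrite [X in _ + X](bigD1 i)//= [X in _ + (_ + X)]big1 => [|k /negbTE ->]; last by rewrite mul0r.
rewrite eqxx mul1r addr0 big_split/= -mulr_sumr; ring.
Qed.

Lemma measurable_linear k (M : 'M[R]_(k, n)) :
  measurable_fun setT (fun x : V => M *m (x : 'cV[R]_n) : borel_vec R k).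
Proof.
apply: measurable_to_vec => i; under eq_fun do rewrite mxE.
apply: measurable_sum => j.
by apply: measurable_funM => //; exact: measurable_coord.
Qed.

Lemma measurable_translate (c : 'cV[R]_n) :
  measurable_fun setT (fun x : V => c + (x : 'cV[R]_n) : V).
Proof.
apply: measurable_to_vec => i; under eq_fun do rewrite mxE.
by apply: measurable_funD => //; exact: measurable_coord.
Qed.

Lemma measurable_quad Q : measurable_fun setT (quad Q : V -> R).
Proof.
rewrite (_ : quad Q = fun u => \sum_k u k 0 * (Q *m u) k 0); last first.
  by apply/funext => u; rewrite quadE.
apply: measurable_sum => k; apply: measurable_funM; first exact: measurable_coord.
under eq_fun do rewrite mxE.
apply: measurable_sum => j; apply: measurable_funM => //; exact: measurable_coord.
Qed.

Lemma set_coord_translate (c x : 'cV[R]_n) i t :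
  c + set_coord i x t = (c + set_coord i x 0) + t *: delta_mx i 0.
Proof. by rewrite set_coordE addrA. Qed.

(** Along an axis [j] where [v] is nonzero, the form is a degenerate quadratic with nonzero
    slope. *)
Lemma gaussian_law_affine_null s m (v : 'rV[R]_n) (c : 'cV[R]_n) : gaussian_law s m ->
  v != 0 -> m [set x : 'cV[R]_n | (v *m (c + x)) 0 0 = 0] = 0%E.
Proof.
move=> gm v0.
have [j vj] : exists j, v 0 j != 0.
  apply/existsP; rewrite -negb_forall; apply: contra v0 => /forallP h.
  by apply/eqP/rowP => j; rewrite mxE; apply/eqP.
apply: (gaussian_law_section (i := j) gm).
  apply: measurable_eq_set => //.
  apply: (measurableT_comp (measurable_coord 0)).
  exact: (measurableT_comp (measurable_linear v) (measurable_translate c)).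
move=> x; have := @quadratic_roots_countable 0 (v 0 j)
  ((v *m (c + set_coord j x 0)) 0 0) (or_intror vj).
apply: sub_countable; apply: subset_card_le => t /=.
by rewrite set_coord_translate mulmx_line mul0r add0r addrC mulrC.
Qed.

(** If some diagonal entry of [Q] is nonzero, the form is a true quadratic along that axis.
    Otherwise it is affine along every axis, and the points with zero slope along a suitable axis
    [i] are removed first. *)
Lemma gaussian_law_quad_null s m (Q : 'M[R]_n) (c : 'cV[R]_n) : gaussian_law s m ->
  (exists u, quad Q u != 0) -> m [set x : 'cV[R]_n | quad Q (c + x) = 0] = 0%E.
Proof.
move=> gm [u0 Qu0]; set S := Q + Q^T.
have mA : measurable ([set x : 'cV[R]_n | quad Q (c + x) = 0] : set V).
  apply: measurable_eq_set => //.
  exact: (measurableT_comp (measurable_quad Q) (measurable_translate c)).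
have [[i Qii]|/forallNP Qii] := pselect (exists i, Q i i != 0).
  apply: (gaussian_law_section (i := i) gm) => // x.
  have := @quadratic_roots_countable _ ((S *m (c + set_coord i x 0)) i 0)
    (quad Q (c + set_coord i x 0)) (or_introl Qii).
  apply: sub_countable; apply: subset_card_le => t /=.
  by rewrite set_coord_translate quad_line.
have {}Qii i : Q i i = 0 by apply/eqP; have /negP := Qii i; rewrite negbK.
(* If [S] were 0, then [Q] would be skew-symmetric and its quadratic form would vanish
   identically. *)
have [i [j Sij]] : exists i j, S i j != 0.
  apply: contrapT => h; move/eqP: Qu0; apply.
  have S0 : S = 0.
    apply/matrixP => i j; rewrite [RHS]mxE; apply/eqP/negPn/negP => Sij.
    by apply: h; exists i, j.
  have QT : quad Q^T u0 = quad Q u0.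
    rewrite /quad -[in RHS](trmxK (u0^T *m Q *m u0)) [RHS]mxE.
    by rewrite !trmx_mul trmxK mulmxA.
  have : quad S u0 = 0 by rewrite S0 /quad mulmx0 mul0mx mxE.
  rewrite /quad mulmxDr mulmxDl mxE -!/(quad _ _) QT => /eqP.
  by rewrite -mulr2n mulrn_eq0/= => /eqP.
have v0 : row i S != 0.
  by apply: contra Sij => /eqP/rowP/(_ j); rewrite !mxE => ->.
pose Z := [set x : 'cV[R]_n | (row i S *m (c + x)) 0 0 = 0].
have mZ : measurable (Z : set V).
  apply: measurable_eq_set => //; apply: (measurableT_comp (measurable_coord 0)).
  exact: (measurableT_comp (measurable_linear (row i S)) (measurable_translate c)).
have Z0 : m Z = 0%E := gaussian_law_affine_null c gm v0.
set A := [set x | _] in mA *.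
have mAZ : measurable (A `\` Z : set V) by exact: measurableD.
have D0 : m (A `\` Z) = 0%E.
  apply: (gaussian_law_section (i := i) gm) => // x.
  (* The slope along axis [i] is thus constant on each line in that direction: the line lies in [Z]
     entirely or not at all. *)
  have Sii : S i i = 0 by rewrite /S !mxE Qii addr0.
  have line t : (row i S *m (c + set_coord i x t)) 0 0 = (S *m (c + set_coord i x 0)) i 0.
    by rewrite -row_mul [LHS]mxE set_coord_translate mulmx_line Sii mulr0 addr0.
  have [b0|b0] := eqVneq ((S *m (c + set_coord i x 0)) i 0) 0.
    by rewrite [X in countable X](_ : _ = set0)// -subset0 => t [_]; apply; rewrite /Z/= line.
  have := @quadratic_roots_countable (Q i i) _ (quad Q (c + set_coord i x 0)) (or_intror b0).
  apply: sub_countable; apply: subset_card_le => t [/=].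
  by rewrite /A/= set_coord_translate quad_line.
apply/eqP; rewrite eq_le measure_ge0 andbT.
apply: (@le_trans _ _ (m ((A `\` Z) `|` Z))).
  apply: le_measure; rewrite ?inE//; first exact: measurableU.
  by move=> x Ax; have [|] := pselect (Z x); [right|left].
by apply: (@le_trans _ _ (m (A `\` Z) + m Z)%E); [exact: measureU2|rewrite D0 Z0 adde0].
Qed.

Lemma noise_measurable d (Omega : measurableType d) (P : probability Omega R) s
    (eps : Omega -> 'cV[R]_n) :
  gaussian_noise P s eps -> measurable_fun setT (eps : Omega -> V).
Proof. by move=> [meps _ _]; apply: measurable_to_vec. Qed.

Lemma noise_law d (Omega : measurableType d) (P : probability Omega R) s
    (eps : Omega -> 'cV[R]_n) (heps : gaussian_noise P s eps) :
  gaussian_law s (image_law P (noise_measurable heps)).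
Proof.
move=> B mB; rewrite [LHS]image_lawE; have [_ nB indep] := heps.
have -> : eps @^-1` box B = [set w | forall i, i \in [set: 'I_n]%SET -> B i (eps w i 0)].
  by apply/seteqP; split=> w /= h i => [_|]; [exact: h|apply: h; rewrite finset.in_setT].
rewrite indep//; apply: eq_big => [i|i _]; first by rewrite finset.in_setT.
exact: nB.
Qed.

Lemma gaussian_law_coord s m i (B : set R) : gaussian_law s m -> measurable B ->
  m [set x : 'cV[R]_n | B (x i 0)] = normal_prob 0 s B.
Proof.
move=> gm mB.
have -> : [set x : 'cV[R]_n | B (x i 0)] = box (fun j => if j == i then B else setT).
  by apply/seteqP; split=> x /= h => [j|]; [case: eqP => // ->|have := h i; rewrite eqxx].
rewrite gm => [|j]; last by case: eqP.
rewrite (bigD1 i)//= eqxx big1 ?mule1// => j /negbTE ->.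
exact: (probability_setT (normal_prob 0 s)).
Qed.

(** Doubling the standard deviation multiplies the unnormalized density by exp(k t^2), which absorbs
    |t| through |t| <= 1 + t^2 <= (1 + 1/k) (1 + k t^2). *)
Lemma normal_pdf_moment_bound s : 0 < s -> exists2 C : R, 0 <= C &
  forall t, `|t| * normal_pdf 0 s t <= C * normal_pdf 0 (2 * s) t.
Proof.
(* The difference of the two exponents: 1/(2 s^2) - 1/(8 s^2). *)
move=> s0; pose k : R := 3 / (8 * s ^+ 2).
have k0 : 0 < k by rewrite divr_gt0// mulr_gt0// exprn_gt0.
have s2 : 2 * s != 0 by rewrite mulf_neq0// gt_eqF.
exists ((1 + k^-1) * (normal_peak s / normal_peak (2 * s))).
  by rewrite mulr_ge0 ?addr_ge0 ?invr_ge0 ?ltW// divr_gt0// normal_peak_gt0// gt_eqF.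
move=> t; rewrite !normal_pdfE ?gt_eqF ?mulr_gt0//.
have np2 : normal_peak (2 * s) != 0 by rewrite gt_eqF// normal_peak_gt0.
have cancel (A B C D : R) : C != 0 -> A * (B / C) * (C * D) = B * (A * D) by move=> ?; field.
rewrite cancel// mulrCA ler_wpM2l ?normal_peak_ge0//.
have -> : normal_fun 0 (2 * s) t = expR (k * t ^+ 2) * normal_fun 0 s t.
  rewrite /normal_fun -expRD; congr expR; rewrite /k; field.
  by rewrite gt_eqF.
rewrite mulrA ler_wpM2r ?normal_fun_ge0//.
apply: (@le_trans _ _ ((1 + k^-1) * (1 + k * t ^+ 2))); last first.
  by rewrite ler_wpM2l ?expR_ge1Dx// addr_ge0// invr_ge0 ltW.
have -> : (1 + k^-1) * (1 + k * t ^+ 2) = 1 + k * t ^+ 2 + k^-1 + t ^+ 2 by field; rewrite gt_eqF.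
have kt : 0 <= k * t ^+ 2 by rewrite mulr_ge0 ?sqr_ge0// ltW.
have kV : 0 < k^-1 by rewrite invr_gt0.
have sq : `|t| <= 1 + t ^+ 2.
  rewrite -(real_normK (num_real t)); have := sqr_ge0 (`|t| - 1).
  have := normr_ge0 t; move: `|t| => u; nra.
by move: (k * t ^+ 2) (k^-1) kt kV => u w u0 w0; lra.
Qed.

Lemma normal_first_moment_lty s : 0 < s ->
  (\int[normal_prob 0 s]_t (`|t|)%:E < +oo)%E.
Proof.
move=> s0.
pose N : probability (measurableTypeR R) R := normal_prob 0 s.
have Nmu := normal_prob_dominates 0 s.
(* The change of variables uses the Radon-Nikodym derivative; comparing integrals over measurable
   sets identifies it almost everywhere with [normal_pdf]. *)
pose g := Radon_Nikodym_SigmaFinite.f N (@lebesgue_measure R).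
have ig : lebesgue_measure.-integrable setT g.
  exact: Radon_Nikodym_SigmaFinite.f_integrable.
have gpdf : ae_eq lebesgue_measure setT g (fun t => (normal_pdf 0 s t)%:E).
  apply: (integral_ae_eq _ ig) => //.
  - exact: measurable_int (integrable_normal_pdf 0 s).
  - by move=> E _ mE; rewrite -Radon_Nikodym_SigmaFinite.f_integral.
have mabs : measurable_fun setT (fun t : R => (`|t|)%:E).
  by apply/measurable_EFinP; exact: normr_measurable.
rewrite [X in (X < _)%E](_ : _ = \int[N]_t (`|t|)%:E)%E//.
rewrite -(Radon_Nikodym_SigmaFinite.change_of_variables Nmu)//.
have mpdf r : measurable_fun setT (fun t : R => (normal_pdf 0 r t)%:E).
  exact: measurable_int (integrable_normal_pdf 0 r).
have [C C0 le_pdf] := normal_pdf_moment_bound s0.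
apply: (@le_lt_trans _ _
  (\int[lebesgue_measure]_t (C%:E * (normal_pdf 0 (2 * s) t)%:E)))%E; last first.
  rewrite ge0_integralZl//; [|exact: mpdf|by move=> t _; rewrite lee_fin normal_pdf_ge0].
  by rewrite integral_normal_pdf mule1 ltry.
rewrite (@ae_eq_integral _ _ R lebesgue_measure setT
  (fun t : measurableTypeR R => (`|t|%:E * (normal_pdf 0 s t)%:E)%E) _)//.
- apply: ge0_le_integral => //.
  + by move=> t _; rewrite -EFinM lee_fin mulr_ge0// normal_pdf_ge0.
  + exact: (emeasurable_funM mabs (mpdf s)).
  + exact: (emeasurable_funM (measurable_cst _) (mpdf (2 * s))).
  + by move=> t _; rewrite -!EFinM lee_fin.
- apply: (emeasurable_funM mabs).
  exact: (measurable_int _ ig).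
- exact: (emeasurable_funM mabs (mpdf s)).
- exact: (ae_eqe_mul2l _ gpdf).
Qed.

Lemma gaussian_law_coord_integrable s m i : 0 < s -> gaussian_law s m ->
  m.-integrable setT (fun x : 'cV[R]_n => (x i 0)%:E).
Proof.
move=> s0 gm; apply/integrableP; split.
  by apply/measurable_EFinP; exact: measurable_coord.
have mi : measurable_fun setT (fun x : V => (x : 'cV[R]_n) i 0 : measurableTypeR R).
  exact: measurable_coord.
have mabs : measurable_fun setT (fun t : measurableTypeR R => (`|t|)%:E).
  by apply/measurable_EFinP; exact: normr_measurable.
rewrite -(ge0_integral_image_law m mi mabs)//.
rewrite (eq_measure_integral (normal_prob 0 s)) => [|A mA _].
  exact: normal_first_moment_lty.
exact: gaussian_law_coord.
Qed.

Lemma gaussian_law_linear_integrable s m (v : 'rV[R]_n) : 0 < s -> gaussian_law s m ->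
  m.-integrable setT (fun x : 'cV[R]_n => ((v *m x) 0 0)%:E).
Proof.
move=> s0 gm.
rewrite (_ : (fun x : 'cV[R]_n => _) =
  fun x : V => (\sum_i (v 0 i)%:E * ((x : 'cV[R]_n) i 0)%:E)%E); last first.
  by apply/funext => x; rewrite mxE -sumEFin; apply: eq_bigr => i _; rewrite EFinM.
apply: (integrable_sum measurableT) => i _; apply: (integrableZl measurableT).
exact: gaussian_law_coord_integrable s0 gm.
Qed.

End GaussianVector.

(** * Variance under translation and change of probability space *)

Section Variance.
Context {R : realType}.

(** Integrability makes the mean finite, so that [fine] commutes with adding [c] and the centred
    variables coincide. *)
Lemma variance_shift d (T : measurableType d) (P : probability T R) (X : T -> R) (c : R) :
  P.-integrable setT (EFin \o X) -> ('V_P[(fun w => X w + c)%R] = 'V_P[X])%E.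
Proof.
move=> iX.
have E : ('E_P[(fun w => X w + c)%R] = 'E_P[X] + c%:E)%E.
  rewrite unlock; under eq_integral do rewrite EFinD.
  rewrite integralD//; last exact: finite_measure_integrable_cst.
  by congr (_ + _)%E; have := expectation_cst P c; rewrite unlock.
have fE : ('E_P[X])%E \is a fin_num by rewrite unlock; exact: integrable_fin_num.
rewrite /variance !covariance.unlock E fineD//=.
set e := fine _; suff -> : (fun w => X w + c) \- cst (e + c) = X \- cst e by [].
by apply/funext => w /=; rewrite opprD addrACA subrr addr0.
Qed.

(** Once the means agree, the remaining integrand is a square, so the transfer of nonnegative
    integrals suffices. *)
Lemma variance_image_law d d' (T : measurableType d) (U : measurableType d')
    (P : probability T R) (f : T -> U) (mf : measurable_fun setT f) (h : U -> R) :
  measurable_fun setT h -> P.-integrable setT (EFin \o (h \o f)) ->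
  ('V_(image_law P mf)[h] = 'V_P[h \o f])%E.
Proof.
move=> mh ih; rewrite /variance !covariance.unlock.
have -> : ('E_(image_law P mf)[h] = 'E_P[h \o f])%E.
  by rewrite !expectation.unlock integral_image_law//; exact/measurable_EFinP.
set e := fine _; rewrite !expectation.unlock ge0_integral_image_law//.
  apply/measurable_EFinP; apply: measurable_funM; exact: measurable_funB.
by move=> y; rewrite lee_fin /GRing.mul_fun/= -expr2 sqr_ge0.
Qed.

Lemma eq_variance d (T : measurableType d) (P P' : probability T R) (X : T -> R) :
  (forall A, measurable A -> P A = P' A) -> ('V_P[X] = 'V_P'[X])%E.
Proof.
move=> PP'.
have E Y : ('E_P[Y] = 'E_P'[Y])%E.
  by rewrite !expectation.unlock; apply: eq_measure_integral => A mA _; exact: PP'.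
by rewrite /variance !covariance.unlock !E.
Qed.

End Variance.

(** * Measurability of the selection events *)

Section MeasurableSelection.
Context {R : realType} {n p : nat} (X : 'M[R]_(n, p)).
Hypothesis hX : row_free X^T.
Hypothesis hpn : (p < n)%N.
Implicit Types (K F : {set 'I_p}) (y : 'cV[R]_n).
Local Notation V := (borel_vec R n).

Lemma RSS_quad K y : RSS X K y = quad ((res_mx X K)^T *m res_mx X K) y.
Proof. by rewrite RSSE// /sqn /quad trmx_mul !mulmxA. Qed.

Lemma measurable_RSS K : measurable_fun setT (RSS X K : V -> R).
Proof.
rewrite (_ : RSS X K = quad ((res_mx X K)^T *m res_mx X K)); first exact: measurable_quad.
by apply/funext => y; rewrite RSS_quad.
Qed.

Lemma measurable_lse K j : measurable_fun setT (fun y : V => lse X K y j 0).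
Proof.
under eq_fun do rewrite lseE//.
exact: (measurableT_comp (measurable_coord j) (measurable_linear _)).
Qed.

Lemma measurable_sqrt : measurable_fun setT (@Num.sqrt R).
Proof. exact: continuous_measurable_fun (@sqrt_continuous R). Qed.

Lemma measurable_t_stat j : measurable_fun setT (fun y : V => t_stat X y j).
Proof.
(* Division is written as a real power -1, measurable in its base; both agree on nonnegative reals,
   including 0. *)
rewrite (_ : (fun y : V => _) = fun y : V => lse X finset.set0 y j 0 *
  (Num.sqrt (RSS X finset.set0 y / (n - p)%:R) *
   Num.sqrt (invmx (X^T *m X) j j)) `^ (- 1)); last first.
  by apply/funext => y; rewrite powR_inv1// mulr_ge0 ?sqrtr_ge0.
apply: measurable_funM; first exact: measurable_lse.
apply: (measurableT_comp (measurable_powR _)).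
apply: measurable_funM => //; apply: (measurableT_comp measurable_sqrt).
by apply: measurable_funM => //; exact: measurable_RSS.
Qed.

Lemma measurable_minimizes (crit : V -> {set 'I_p} -> R) F K :
  (forall L, measurable_fun setT (crit^~ L)) ->
  measurable ([set y | minimizes (crit y) F K] : set V).
Proof.
move=> mc; have [KF|KF] := boolP (K \subset F); last first.
  by rewrite (_ : [set y | _] = set0)// -subset0 => y [KF2]; rewrite KF2 in KF.
rewrite (_ : [set y | _] =
  \bigcap_(L in [set L : {set 'I_p} | L \subset F]) [set y | crit y K <= crit y L]).
  by apply: fin_bigcap_measurable => // L _; exact: measurable_le_set.
by apply/seteqP; split=> y /=; [move=> [_ h] L; exact: h|move=> h; split=> // L LF; exact: h].
Qed.

Lemma measurable_selects meth crit_val F K :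
  measurable ([set y | selects X meth crit_val F y K] : set V).
Proof.
have minfo f : measurable ([set y | minimizes (info_criterion X f y) F K] : set V).
  apply: measurable_minimizes => L.
  apply: measurable_funD => //; apply: measurable_funM => //.
  exact: (measurableT_comp (@measurable_ln R) (measurable_RSS L)).
case: meth => /=; [exact: minfo|exact: minfo| | |].
- apply: measurable_minimizes => L; apply: measurable_funD => //; apply: measurable_funD => //.
  rewrite (_ : (fun y : V => _) = fun y : V => RSS X L y *
    (RSS X finset.set0 y / (n - p)%:R) `^ (- 1)); last first.
    by apply/funext => y; rewrite powR_inv1// mulr_ge0 ?invr_ge0// RSS_ge0.
  apply: measurable_funM; first exact: measurable_RSS.
  apply: (measurableT_comp (measurable_powR _)).
  by apply: measurable_funM => //; exact: measurable_RSS.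
- apply: measurable_minimizes => L.
  by apply: measurable_funM => //; exact: measurable_RSS.
(* Equality of [K] with the accepted set is tested index by index. *)
- pose Sj j := if j \in F then
    if j \in K then [set y : V | `|t_stat X y j| < crit_val j]
    else [set y : V | crit_val j <= `|t_stat X y j|] else
    if j \in K then set0 else setT.
  have mt j : measurable_fun setT (fun y : V => `|t_stat X y j|).
    exact: (measurableT_comp (@normr_measurable R setT) (measurable_t_stat j)).
  rewrite (_ : [set y | _] = \bigcap_(j in [set: 'I_p]) Sj j).
    apply: fin_bigcap_measurable => // j _; rewrite /Sj.
    case: ifP => _; case: ifP => _ //.
      exact: measurable_lt_set.
    exact: measurable_le_set.
  apply/seteqP; split=> y /=.
    move=> KE j _; rewrite /Sj; have : j \in K = (j \in F) && (`|t_stat X y j| < crit_val j).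
      by rewrite {1}KE inE.
    case: (j \in K); case: (j \in F) => //= /esym //.
    by move/negbT; rewrite -leNgt.
  move=> h; apply/setP => j; have := h j Logic.I; rewrite /Sj inE.
  case: (j \in K); case: (j \in F) => //=; by [move=> ->|rewrite leNgt => /negbTE ->].
Qed.

End MeasurableSelection.

(** * Coverage *)

Section NoiseProbability.
Context {R : realType} {n : nat} {d : measure_display} {Omega : measurableType d}.
Local Notation V := (borel_vec R n).
Variables (s : R) (m : probability V R) (P : probability Omega R).
Variable eps : Omega -> 'cV[R]_n.
Hypotheses (gm : gaussian_law s m) (heps : gaussian_noise P s eps).

(** This allows events under different [beta] with the same sigma to be compared under a single
    law. *)
Lemma noise_prob (A : set V) : measurable A -> P [set w | A (eps w)] = m A.
Proof.
move=> mA; rewrite -[LHS](image_lawE P (noise_measurable heps)).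
apply: measure_vec_unique => // B mB.
by rewrite [RHS]gm// [LHS](noise_law heps mB).
Qed.

Lemma noise_event_measurable (A : set V) : measurable A -> measurable [set w | A (eps w)].
Proof. by move=> mA; rewrite -[X in measurable X]setTI; exact: (noise_measurable heps). Qed.

Lemma noise_variance (v : 'rV[R]_n) (c : R) : 0 < s ->
  ('V_P[(fun w => (v *m eps w) 0 0 + c)%R] = 'V_m[(fun x : V => (v *m (x : 'cV[R]_n)) 0 0)%R])%E.
Proof.
move=> s0; pose h (x : V) : R := (v *m (x : 'cV[R]_n)) 0 0.
have mh : measurable_fun setT h.
  exact: (measurableT_comp (measurable_coord 0) (measurable_linear v)).
have mabs : measurable_fun setT (fun x : V => `|(h x)%:E|%E).
  by apply: measurableT_comp => //; exact/measurable_EFinP.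
have ih : P.-integrable setT (EFin \o (h \o eps)).
  apply/integrableP; split.
    by apply/measurable_EFinP; exact: (measurableT_comp mh (noise_measurable heps)).
  have /integrableP[_] := gaussian_law_linear_integrable v s0 (noise_law heps).
  by rewrite (ge0_integral_image_law P (noise_measurable heps) mabs).
rewrite (variance_shift _ ih) -(variance_image_law (noise_measurable heps) mh ih).
apply: eq_variance => A mA; rewrite [LHS]image_lawE; exact: noise_prob.
Qed.

End NoiseProbability.

(** * Comparison of coverages along a diverging direction *)

Section Coverage.
Context {R : realType} {n p : nat} {d : measure_display} {Omega : measurableType d}.
Variables (X : 'M[R]_(n, p)) (a : 'cV[R]_p) (t : nat -> R).
Hypotheses (hX : row_free X^T) (hpn : (p < n)%N).
Variables (Pr : 'cV[R]_p -> R -> probability Omega R) (Y : Omega -> 'cV[R]_n).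
Hypothesis hmodel : gaussian_linear_model X Pr Y.
Variables (meth : selection_method) (crit_val : 'I_p -> R).
Variables (beta : 'cV[R]_p) (sigma : R).
Hypothesis sigma0 : 0 < sigma.
Implicit Types (K F G : {set 'I_p}) (y : 'cV[R]_n) (c b : 'cV[R]_p).

Local Notation V := (borel_vec R n).
Local Notation RSS0 := (RSS X finset.set0).
Local Notation sel := (selects X meth crit_val).
Local Notation ci b K y := (theta a b \in conf_interval X a t Pr Y b sigma K y).

Let law : probability V R := image_law (Pr beta sigma) (noise_measurable (hmodel beta sigma0)).

Let law_gaussian : gaussian_law sigma law.
Proof. exact: noise_law. Qed.

(** The estimator is an affine function of the noise; [b] only enters its constant term. *)
Lemma v_const b K : v X a Pr Y b sigma K = v X a Pr Y beta sigma K.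
Proof.
suff E b' : ('V_(Pr b' sigma)[(fun w => theta a (lse X K (Y w)))%R] =
    'V_law[(fun x : V => (a^T *m lse_mx X K *m (x : 'cV[R]_n)) 0 0)%R])%E.
  by rewrite /v !E.
rewrite -(noise_variance law_gaussian (hmodel b' sigma0) _
  ((a^T *m lse_mx X K *m (X *m b')) 0 0) sigma0).
congr ('V_(_)[_])%E; apply/funext => w; rewrite /theta lseE// mulmxA.
by rewrite -[in LHS](subrK (X *m b') (Y w)) mulmxDr mxE.
Qed.

(** The target and both endpoints move by the same amount, the half-width being unchanged. *)
Lemma conf_interval_shift K y c : restricted K c ->
  ci (beta + c) K (y + X *m c) = ci beta K y.
Proof.
move=> Kc; rewrite !in_itv/= /half_width v_const /mean_RSS RSS_shift// lse_shift//.
have thetaD b b' : theta a (b + b') = theta a b + theta a b'.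
  by rewrite /theta mulmxDr mxE.
by rewrite !thetaD addrAC lerD2r [X in _ && (_ <= X)]addrAC lerD2r.
Qed.

Lemma measurable_ci b K : measurable ([set y | ci b K y] : set V).
Proof.
have mth : measurable_fun setT (fun y : V => theta a (lse X K y)).
  rewrite (_ : (fun y : V => _) = fun y : V => (a^T *m lse_mx X K *m (y : 'cV[R]_n)) 0 0).
    exact: (measurableT_comp (measurable_coord 0) (measurable_linear _)).
  by apply/funext => y; rewrite /theta lseE// mulmxA.
have mhw : measurable_fun setT (fun y : V => half_width X a t Pr Y b sigma K y).
  apply: measurable_funM => //; apply: measurable_funM => //.
  apply: (measurableT_comp measurable_sqrt); apply: measurable_funM => //.
  exact: measurable_RSS.
rewrite (_ : [set y | _] =
    [set y : V | theta a (lse X K y) - half_width X a t Pr Y b sigma K y <= theta a b] `&`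
    [set y : V | theta a b <= theta a (lse X K y) + half_width X a t Pr Y b sigma K y]).
  apply: measurableI; apply: measurable_le_set => //.
    exact: measurable_funB.
  exact: measurable_funD.
by apply/seteqP; split=> y /=; rewrite in_itv/= => /andP.
Qed.

Definition untied G y : Prop := 0 < RSS0 y /\
  forall K K', sel G y K -> sel G y K' -> K = K'.

(** [N] is a finite union of null quadrics: the zero set of the unrestricted RSS and one tie
    relation for each pair of sets. *)
Lemma untied_ae G : exists N : set V, [/\ measurable N, law N = 0%E &
  forall x, ~ N x -> untied G (X *m beta + x)].
Proof.
pose Qm K : 'M[R]_n := (res_mx X K)^T *m res_mx X K.
have QmE K y : RSS X K y = quad (Qm K) y := RSS_quad hX K y.
pose Q0 := Qm finset.set0; have Q0E y : RSS0 y = quad Q0 y := QmE _ y.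
have tie (KK : {set 'I_p} * {set 'I_p}) : exists Q : 'M[R]_n, (exists u, quad Q u != 0) /\
    forall y, 0 < RSS0 y -> KK.1 != KK.2 -> sel G y KK.1 -> sel G y KK.2 -> quad Q y = 0.
  have [e|KK'] := eqVneq KK.1 KK.2.
    (* A harmless nonzero form, so that [Q] is defined on all pairs. *)
    exists Q0; split; last by move=> y _; rewrite e.
    by have [u u0] := RSS_set0_neq0 hX hpn; exists u; rewrite -Q0E.
  have [c [e [c0 h]]] := selects_tie hX hpn meth crit_val G KK'.
  exists (Qm KK.1 - c *: Qm KK.2 - e *: Q0).
  have E y : quad (Qm KK.1 - c *: Qm KK.2 - e *: Q0) y =
      RSS X KK.1 y - c * RSS X KK.2 y - e * RSS0 y.
    by rewrite (QmE KK.1) (QmE KK.2) (Q0E y); exact: quad_lincomb.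
  split; first by have [u] := RSS_tie_nontrivial hX e KK' c0; exists u; rewrite E.
  by move=> y y0 _ s1 s2; rewrite E (h y y0 s1 s2) addrAC addrK subrr.
pose Q KK := sval (cid (tie KK)).
have QP KK := svalP (cid (tie KK)).
pose Z (S : 'M[R]_n) : set V := [set x : 'cV[R]_n | quad S (X *m beta + x) = 0].
have mZ S : measurable (Z S).
  apply: measurable_eq_set => //.
  exact: (measurableT_comp (measurable_quad S) (measurable_translate (X *m beta))).
have nZ S : (exists u, quad S u != 0) -> law.-negligible (Z S).
  by move=> S0; apply/negligibleP => //; exact: gaussian_law_quad_null law_gaussian S0.
have mN : measurable (Z Q0 `|` \big[setU/set0]_KK Z (Q KK)).
  by apply: measurableU => //; apply: bigsetU_measurable.
exists (Z Q0 `|` \big[setU/set0]_KK Z (Q KK)); split => //.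
- apply: measure_negligible => //; apply: negligibleU.
    by apply: nZ; have [u u0] := RSS_set0_neq0 hX hpn; exists u; rewrite -Q0E.
  apply: big_ind => [|A B|KK _]; [exact: negligible_set0|exact: negligibleU|].
  by apply: nZ; have [] := QP KK.
- move=> x /not_orP[nZ0 nZQ].
  have y0 : 0 < RSS0 (X *m beta + x).
    by rewrite lt_neqAle RSS_ge0// andbT eq_sym; apply/eqP; rewrite Q0E.
  split=> // K K' sK sK'; apply/eqP/negPn/negP => KK'; apply: nZQ.
  rewrite (bigD1 (K, K'))//=; left; have [_ h] := QP (K, K').
  exact: (h _ y0 KK' sK sK').
Qed.

Lemma selects_unshift F y c K : restricted F c -> sel F (y + X *m c) K -> sel F y K.
Proof.
move=> Fc sK; have KF := selects_subset sK.
have Fc' : restricted F (- c) by move=> i iF; rewrite mxE Fc// oppr0.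
by have := selects_shift hX KF Fc' sK; rewrite mulmxN addrK.
Qed.

Lemma untied_shift G y c : restricted G c -> untied G y -> untied G (y + X *m c).
Proof.
move=> Gc [y0 u]; split; first by rewrite RSS_shift// => i; rewrite inE.
by move=> K K' sK sK'; apply: u; exact: selects_unshift Gc _.
Qed.

Lemma shifted_selects_measurable F K (z : 'cV[R]_n) :
  measurable ([set x | sel F (z + x) K] : set V).
Proof.
rewrite -[X in measurable X]setTI.
exact: (measurable_translate z _ (measurable_selects hX _ _ _ _)).
Qed.

(** A set of noise vectors that refers to no particular selection rule; off the tie set, the witness
    [K] is the one that any rule picks. *)
Definition covering G : set V :=
  [set x | exists K, sel G (X *m beta + x) K /\ ci beta K (X *m beta + x)].

Lemma covering_measurable G : measurable (covering G).
Proof.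
rewrite (_ : covering G = \bigcup_(K in [set: {set 'I_p}])
    ([set x : V | sel G (X *m beta + x) K] `&` [set x : V | ci beta K (X *m beta + x)])).
  apply: fin_bigcup_measurable => // K _; apply: measurableI.
    exact: shifted_selects_measurable.
  rewrite -[X in measurable X]setTI.
  exact: (measurable_translate (X *m beta) _ (measurable_ci _ _)).
by apply/seteqP; split=> x [K]; [move=> [? ?]; exists K|move=> _ [? ?]; exists K].
Qed.

Lemma coverage_event_measurable (Ksel : 'cV[R]_n -> {set 'I_p}) b :
  (forall K, measurable [set w | Ksel (Y w) = K]) ->
  measurable [set w | ci b (Ksel (Y w)) (Y w)].
Proof.
move=> mK; rewrite (_ : [set w | _] = \bigcup_(K in [set: {set 'I_p}])
    ([set w | Ksel (Y w) = K] `&` [set w | ci b K (X *m b + (Y w - X *m b))])).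
  apply: fin_bigcup_measurable => // K _; apply: measurableI => //.
  apply: (noise_event_measurable (hmodel b sigma0)
    (A := [set x : V | ci b K (X *m b + x)])).
  rewrite -[X in measurable X]setTI.
  exact: (measurable_translate (X *m b) _ (measurable_ci _ _)).
apply/seteqP; split=> [w cw|w [K _ [<-]]]; last by rewrite /mkset subrKC.
exists (Ksel (Y w)); first exact: Logic.I.
by split; [exact: erefl|rewrite /mkset subrKC].
Qed.

Lemma coverage_ge (Ksel : 'cV[R]_n -> {set 'I_p}) G :
  (forall K, measurable [set w | Ksel (Y w) = K]) ->
  selection_rule X meth crit_val G Ksel ->
  (law (covering G) <= coverage X a t Pr Y Ksel beta sigma)%E.
Proof.
move=> mK rule; have [N [mN N0 NP]] := untied_ae G.
have mC := covering_measurable G.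
have mD : measurable (covering G `\` N) by exact: measurableD.
apply: (@le_trans _ _ (law (covering G `\` N) + law N)%E).
  apply: (@le_trans _ _ (law ((covering G `\` N) `|` N))); last exact: measureU2.
  apply: le_measure; rewrite ?inE//; first exact: measurableU.
  by move=> x Cx; have [|] := pselect (N x); [right|left].
rewrite N0 adde0 -(noise_prob law_gaussian (hmodel beta sigma0) mD).
apply: le_measure; rewrite ?inE.
- exact: (noise_event_measurable (hmodel beta sigma0) mD).
- exact: coverage_event_measurable.
- move=> w [[K [sK cK]] nN]; have [y0 u] := NP _ nN.
  move: sK cK y0 u; rewrite subrKC => sK cK y0 u.
  by rewrite /= (u _ _ (rule _ y0) sK).
Qed.

(** The noise vectors for which, after a shift by [s], a set not contained in [G] can still be
    selected. *)
Definition overfit F G (N : set V) c (s : nat) : set V :=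
  ~` N `&` \bigcup_(K in [set K : {set 'I_p} | ~~ (K \subset G)])
    [set x | sel F (X *m beta + s%:R *: (X *m c) + x) K].

Lemma overfit_measurable F G N c s : measurable N -> measurable (overfit F G N c s).
Proof.
move=> mN; apply: measurableI; first exact: measurableC.
by apply: fin_bigcup_measurable => // K _; exact: shifted_selects_measurable.
Qed.

(** Each fixed noise vector outside [N] leaves these events for good from some [s] on. *)
Lemma overfit_lim_sup F G N c : (forall x, ~ N x -> untied G (X *m beta + x)) ->
  (forall i, i \in F -> i \notin G -> c i 0 != 0) ->
  lim_sup_set (overfit F G N c) = set0.
Proof.
move=> NP Fc; rewrite -subset0 => x xs.
have nN : ~ N x by have [s _ []] := xs 0%N Logic.I.
have [y0 _] := NP _ nN.
have [M HM] := selects_eventually hX hpn meth crit_val y0 Fc.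
have [s /= Ms [_ [K /= /negP KG]]] := xs M Logic.I.
by rewrite addrAC => /(HM s Ms).
Qed.

(** Off [N], the selected set either escapes [G], which is an overfit event, or is also selected
    within [G] from the unshifted data, where it covers equally well. *)
Lemma coverage_le (Ksel : 'cV[R]_n -> {set 'I_p}) F G (N : set V) c s :
  G \subset F -> restricted G c ->
  measurable N -> law N = 0%E -> (forall x, ~ N x -> untied G (X *m beta + x)) ->
  (forall K, measurable [set w | Ksel (Y w) = K]) ->
  selection_rule X meth crit_val F Ksel ->
  (coverage X a t Pr Y Ksel (beta + s%:R *: c) sigma <=
    law (covering G) + law (overfit F G N c s))%E.
Proof.
move=> GF Gc mN N0 NP mK rule; set b := beta + s%:R *: c.
have mC := covering_measurable G; have mB := overfit_measurable F G c s mN.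
have mU : measurable (covering G `|` overfit F G N c s `|` N) by do 2 apply: measurableU => //.
apply: (@le_trans _ _ (law (covering G `|` overfit F G N c s `|` N))).
  rewrite -(noise_prob law_gaussian (hmodel b sigma0) mU).
  apply: le_measure; rewrite ?inE.
  - exact: coverage_event_measurable.
  - exact: (noise_event_measurable (hmodel b sigma0) mU).
  move=> w /= cw; set x := Y w - X *m b.
  have [Nx|nN] := pselect (N x); first by right.
  left; have Gsc : restricted G (s%:R *: c) by move=> i iG; rewrite mxE Gc// mulr0.
  have Yw : Y w = X *m beta + x + X *m (s%:R *: c).
    by rewrite addrAC -mulmxDr /x subrKC.
  have [y0 u] := untied_shift Gsc (NP _ nN).
  rewrite -Yw in y0 u; have sK := rule _ y0.
  have [KG|KG] := boolP (Ksel (Y w) \subset G); last first.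
    right; split; first exact: nN.
    exists (Ksel (Y w)); first exact: KG.
    by rewrite /mkset scalemxAr addrAC -Yw.
  left; exists (Ksel (Y w)); have sG := selects_sub GF KG sK.
  split; first by apply: (selects_unshift Gsc); rewrite -Yw.
  by rewrite -(conf_interval_shift _ (restricted_subset KG Gsc)) -Yw.
apply: (@le_trans _ _ (law (covering G `|` overfit F G N c s) + law N)%E).
  by apply: measureU2 => //; exact: measurableU.
by rewrite N0 adde0; exact: measureU2.
Qed.

Lemma min_coverage_le (Kt Ks : 'cV[R]_n -> {set 'I_p}) F G : G \subset F ->
  (forall K, measurable [set w | Kt (Y w) = K]) ->
  (forall K, measurable [set w | Ks (Y w) = K]) ->
  selection_rule X meth crit_val F Kt -> selection_rule X meth crit_val G Ks ->
  (min_coverage X a t Pr Y Kt <= coverage X a t Pr Y Ks beta sigma)%E.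
Proof.
move=> GF mKt mKs rt rs; apply: le_trans (coverage_ge mKs rs).
have [N [mN N0 NP]] := untied_ae G.
(* All coefficients outside [G] are pushed, including those outside [F]; divergence only uses the
   entries in [F] but not in [G]. *)
pose c : 'cV[R]_p := \col_i (i \notin G)%:R.
have Gc : restricted G c by move=> i iG; rewrite mxE iG.
have Fc i : i \in F -> i \notin G -> c i 0 != 0 by move=> _ iG; rewrite mxE iG oner_eq0.
have mB s := overfit_measurable F G c s mN.
(* Continuity from above: the tail unions decrease to the limit superior, which is empty. *)
have lB : law (\bigcup_(k >= s) overfit F G N c k) @[s --> \oo] --> 0%E.
  have := lim_sup_set_cvg law (overfit F G N c) mB.
  rewrite (overfit_lim_sup NP Fc) measure0; apply.
  rewrite -ge0_fin_numE// fin_num_measure//; exact: bigcup_measurable.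
have cB : (law (covering G) + law (\bigcup_(k >= s) overfit F G N c k))%E @[s --> \oo]
    --> law (covering G).
  rewrite -[X in _ --> X]adde0; apply: cvgeD => //; last exact: cvg_cst.
  by rewrite fin_num_adde_defl// fin_num_measure//; exact: covering_measurable.
(* The bound passes to the limit: for each [s] the minimum coverage is at most the coverage at the
   shifted parameter. *)
rewrite -(cvg_lim _ cB)//; apply: lime_ge; first by apply/cvg_ex; eexists; exact: cB.
near=> s; apply: (@le_trans _ _ (coverage X a t Pr Y Kt (beta + s%:R *: c) sigma)).
  by apply: ereal_inf_lbound; exists (beta + s%:R *: c), sigma.
apply: le_trans (coverage_le s GF Gc mN N0 NP mKt rt) _.
apply: leeD2l; apply: le_measure; rewrite ?inE//; first exact: bigcup_measurable.
by move=> x xs; exists s => /=.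
Unshelve. all: by end_near. Qed.

End Coverage.

Theorem theorem2 (R : realType) (n p q l : nat)
  (hq : (1 <= q)%N) (hql : (q < l)%N) (hlp : (l < p)%N) (hpn : (p < n)%N)
  (X : 'M[R]_(n, p)) (hX : row_free X^T)
  (a : 'cV[R]_p) (ha : a != 0)
  (alpha : R) (halpha : 0 < alpha < 1)
  (t : nat -> R)
  (ht : forall m : nat, (0 < m)%N ->
    student_prob m [set` `[- t m, t m]] = (1 - alpha)%:E)
  (d : measure_display) (Omega : measurableType d)
  (Pr : 'cV[R]_p -> R -> probability Omega R) (Y : Omega -> 'cV[R]_n)
  (hmodel : gaussian_linear_model X Pr Y)
  (meth : selection_method) (crit_val : 'I_p -> R)
  (Ktilde Kstar : 'cV[R]_n -> {set 'I_p})
  (hKtilde_meas : forall K, measurable [set w | Ktilde (Y w) = K])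
  (hKstar_meas : forall K, measurable [set w | Kstar (Y w) = K])
  (hKtilde : selection_rule X meth crit_val (indices_after p q) Ktilde)
  (hKstar : selection_rule X meth crit_val (indices_after p l) Kstar) :
  forall (beta : 'cV[R]_p) (sigma : R), 0 < sigma ->
    (min_coverage X a t Pr Y Ktilde <= coverage X a t Pr Y Kstar beta sigma)%E.
Proof.
move=> beta sigma sigma0.
apply: (min_coverage_le a t hX hpn hmodel beta sigma0 _ hKtilde_meas hKstar_meas hKtilde hKstar).
by apply/fintype.subsetP => i; rewrite !inE; exact: leq_trans (ltnW hql).
Qed.
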